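(* Let $\mathcal D$ be a filtered $\varphi$-module, $\mathcal B=(v_1,\dots,v_d)$ a basis adapted to the filtration, $J$ a finite interval of $\mathbb Z$ containing $]t_{HT,1},t'_{HT,d}]$, $N\ge0$, and let $(Z_n)_{n\ge N-1}$ be the sequence of $\mathcal H$-linear endomorphisms of $\mathcal H\otimes_{\mathbb Q_p}\mathcal D$ defined by $Z_{N-1}=\mathrm{Id}$ and $Z_n=(1\otimes\varphi)^{n+1}T_n(1\otimes\varphi)^{-(n+1)}Z_{n-1}$ for $n\ge N$. Then for all $n\ge N$, $Z_{n+1}\equiv Z_n\pmod{\omega_n^{J}}$ (i.e. all matrix entries of $Z_{n+1}-Z_n$ in a basis of $\mathcal D$ are divisible by $\omega_n^J$ in $\mathcal H$). For every $v\in\mathcal D$ the sequence $Z_n(v)$ converges in $\mathcal H\otimes\mathcal D$; the determinant of the limit $Z_\infty$ is equal, up to a unit of $\mathcal H$, to $\prod_{k=1}^d\Xi_N^{]t_{HT,k},t_{HT,d}]\subset J}$.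
   Context: Let $p$ be an odd prime and $u$ a topological generator of $1+p\mathbb Z_p$. $\mathcal H$ is the ring of power series in $\mathbb Q_p[[x]]$ converging on the open unit disc of $\mathbb C_p$ (Fréchet topology given by $\|f\|_\rho=\sup_{|z|_p\le\rho}|f(z)|_p$, $\rho<1$). For $f\in\mathbb Q_p[[x]]$, $f^{(j)}(x)=f(u^{-j}(1+x)-1)$; $\omega_n=(1+x)^{p^n}-1$, $\xi_n=\omega_n/\omega_{n-1}$ ($n\ge1$), $\xi_0=px$; for finite $S\subset\mathbb Z$, $\omega_n^S=\prod_{j\in S}\omega_n^{(j)}$, $\ell_n^S=\prod_{j\in S}\xi_n^{(j)}/p$ (empty product $1$). For a finite interval $J$, a subinterval $J'\subseteq J$ (possibly empty) and $n\ge1$, $\tilde\xi_n^{J'\subset J}$ is the unique polynomial of $\mathbb Q_p[x]$ of degree $<((p-1)|J'|+|J|)p^{n-1}$ with $\tilde\xi_n^{J'\subset J}\equiv\xi_n^{(j)}/p\pmod{\omega_n^{(j)}}$ ($j\in J'$) and $\equiv1\pmod{\omega_{n-1}^{(j)}}$ ($j\in J\setminus J'$); $\tilde\xi_0^{J'\subset J}=\ell_0^{J'}$; $\Xi_N^{J'\subset J}=\prod_{m\ge N}\tilde\xi_m^{J'\subset J}\in\mathcal H$ (convergent product). A filtered $\varphi$-module is a $d$-dimensional $\mathbb Q_p$-vector space $\mathcal D$ with a bijective linear $\varphi$ and a decreasing exhaustive separated filtration $\mathrm{Fil}^\bullet\mathcal D$; its Hodge–Tate weights $t_{HT,1}\le\dots\le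 t_{HT,d}$ are the $i$ with $\mathrm{Fil}^i\ne\mathrm{Fil}^{i+1}$ counted with multiplicity $\dim\mathrm{Fil}^i/\mathrm{Fil}^{i+1}$; $t_{N,1}\le\dots\le t_{N,d}$ are the $p$-adic valuations of the eigenvalues of $\varphi$; $t'_{HT,d}$ is the smallest integer $\ge t_{HT,d}$ with $t'_{HT,d}-t_{HT,1}>t_{N,d}-t_{N,1}$. A basis $(v_i)$ is adapted to the filtration if $v_i\in\mathrm{Fil}^{t_{HT,i}}\mathcal D$. For integers $a\le b$, $]a,b]=\{j\in\mathbb Z: a<j\le b\}$. For $n\ge0$, $T_n$ is the $\mathcal H$-linear endomorphism of $\mathcal H\otimes\mathcal D$ with $T_n(v_i)=\tilde\xi_n^{]t_{HT,i},t_{HT,d}]\subset J}\,v_i$. *)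

(* Defs.v *)
From HB Require Import structures.
From mathcomp Require Import all_boot all_order all_algebra.
From mathcomp Require Import all_classical all_reals all_analysis.
Set Implicit Arguments. Unset Strict Implicit. Unset Printing Implicit Defensive.
Import Order.TTheory GRing.Theory Num.Theory.
Import numFieldNormedType.Exports.
Local Open Scope classical_set_scope. Local Open Scope ring_scope.

From Stdlib Require Import ClassicalEpsilon.

Section FPS.
Variable R : comNzRingType.
Definition fps : Type := nat -> R.
HB.instance Definition _ := GRing.Zmodule.copy fps (nat -> R).

Lemma fps_addE (f g : fps) n : (f + g) n = f n + g n.
Proof. by []. Qed.

Definition fps_one : fps := fun n => (n == 0%N)%:R.
Definition fps_mul (a b : fps) : fps := fun n => \sum_(i < n.+1) a i * b (n - i)%N.
Definition fps_trunc (a : fps) (n : nat) : {poly R} := \poly_(i < n.+1) a i.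

Lemma fps_mul_trunc a b n m : (m <= n)%N ->
  (fps_trunc a n * fps_trunc b n)`_m = fps_mul a b m.
Proof.
move=> mn; rewrite coefM /fps_mul; apply: eq_bigr => i _.
rewrite !coef_poly; have hi : (i < n.+1)%N by apply: leq_trans (ltn_ord i) _.
rewrite hi ifT //; rewrite ltnS; apply: leq_trans (leq_subr _ _) mn.
Qed.

Lemma coefM_agree (P P' Q : {poly R}) n :
  (forall k, (k <= n)%N -> P`_k = P'`_k) -> (P * Q)`_n = (P' * Q)`_n.
Proof.
move=> h; rewrite !coefM; apply: eq_bigr => i _; rewrite h //.
by rewrite -ltnS.
Qed.

Lemma coefM_agree_r (P Q Q' : {poly R}) n :
  (forall k, (k <= n)%N -> Q`_k = Q'`_k) -> (P * Q)`_n = (P * Q')`_n.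
Proof. by move=> h; rewrite ![P * _]mulrC; apply: coefM_agree. Qed.

Lemma trunc_mul a b n k : (k <= n)%N ->
  (fps_trunc (fps_mul a b) n)`_k = (fps_trunc a n * fps_trunc b n)`_k.
Proof. by move=> kn; rewrite fps_mul_trunc // coef_poly ltnS kn. Qed.

Lemma fps_mulA : associative fps_mul.
Proof.
move=> a b c; apply: funext => n.
rewrite -!(@fps_mul_trunc _ _ n) //.
rewrite (@coefM_agree_r (fps_trunc a n) _ (fps_trunc b n * fps_trunc c n)); last first.
  by move=> k kn; rewrite trunc_mul.
rewrite (@coefM_agree _ (fps_trunc a n * fps_trunc b n) (fps_trunc c n)); last first.
  by move=> k kn; rewrite trunc_mul.
by rewrite mulrA.
Qed.

Lemma fps_mulC : commutative fps_mul.
Proof.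
move=> a b; apply: funext => n.
by rewrite -!(@fps_mul_trunc _ _ n) // mulrC.
Qed.

Lemma fps_mul1 : left_id fps_one fps_mul.
Proof.
move=> b; apply: funext => n.
rewrite -(@fps_mul_trunc _ _ n) //.
have -> : fps_trunc fps_one n = 1.
  apply/polyP => k; rewrite coef_poly coef1 /fps_one.
  by case: ifP => // /negbT; rewrite -leqNgt; case: k.
by rewrite mul1r coef_poly ltnS leqnn.
Qed.

Lemma fps_mulDl : left_distributive fps_mul +%R.
Proof.
move=> a b c; apply: funext => n.
rewrite /fps_mul !fps_addE -big_split /=; apply: eq_bigr => i _.
by rewrite fps_addE mulrDl.
Qed.

Lemma fps_one_neq0 : fps_one != 0.
Proof.
apply/eqP => h; have := congr1 (fun f : fps => f 0%N) h.
by rewrite /fps_one /= => /eqP; rewrite oner_eq0.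
Qed.

HB.instance Definition _ := GRing.Zmodule_isComNzRing.Build fps
  fps_mulA fps_mulC fps_mul1 fps_mulDl fps_one_neq0.

Definition fps_of_poly (P : {poly R}) : fps := fun n => P`_n.
End FPS.

Definition cvg_abs (R : realType) (C : zmodType) (abs : C -> R)
  (s : nat -> C) (l : C) : Prop :=
  (fun n => abs (s n - l)) @ \oo --> (0 : R).

Definition cauchy_abs (R : realType) (C : zmodType) (abs : C -> R)
  (s : nat -> C) : Prop :=
  forall e : R, 0 < e -> exists M : nat,
    forall m n : nat, (M <= m)%N -> (M <= n)%N -> abs (s m - s n) < e.

(* The p-adic setting: Qp is a field, complete for the restriction of an    *)
(* ultrametric absolute value with |p| = 1/p, in which Q is dense (this      *)
(* characterises Q_p up to isometric isomorphism); Cp is an algebraically    *)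
(* closed, complete valued field containing Qp (e.g. C_p itself).            *)
Record QpSetting (R : realType) (p : nat) := {
  Qp : fieldType;
  Cp : closedFieldType;
  emb : {rmorphism Qp -> Cp};
  absC : Cp -> R;
  absC_eq0 : forall x, (absC x == 0) = (x == 0);
  absC_ge0 : forall x, 0 <= absC x;
  absCM : forall x y, absC (x * y) = absC x * absC y;
  absC_ultra : forall x y, absC (x + y) <= Num.max (absC x) (absC y);
  absC_p : absC p%:R = p%:R^-1;
  Cp_complete : forall s : nat -> Cp,
      cauchy_abs absC s -> exists l, cvg_abs absC s l;
  Qp_complete : forall s : nat -> Qp,
      cauchy_abs absC (fun n => emb (s n)) ->
      exists l, cvg_abs absC (fun n => emb (s n)) (emb l);
  Qp_rat_dense : forall (x : Qp) (e : R), 0 < e ->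
      exists q : rat, absC (emb x - emb (ratr q)) < e
}.

Section Padic.
Variables (R : realType) (p : nat) (S : QpSetting R p).
Local Notation K := (Qp S).
Local Notation L := (Cp S).
Local Notation emb := (@emb _ _ S).
Local Notation absC := (@absC _ _ S).

Definition absQ (x : K) : R := absC (emb x).

Definition topgen (u : K) : Prop :=
  absQ (u - 1) <= p%:R^-1 /\
  forall w : K, absQ (w - 1) <= p%:R^-1 ->
    forall e : R, 0 < e -> exists k : int, absQ (u ^ k - w) < e.

Definition psum (f : fps K) (z : L) (n : nat) : L :=
  \sum_(i < n) emb (f i) * z ^+ i.

Definition inH (f : fps K) : Prop :=
  forall z : L, absC z < 1 -> exists l, cvg_abs absC (psum f z) l.

Definition normH (rho : R) (f : fps K) : R :=
  sup [set r | exists z l, absC z <= rho /\ cvg_abs absC (psum f z) l /\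
                           r = absC l].

Definition cvgH (g : nat -> fps K) (f : fps K) : Prop :=
  forall rho : R, 0 < rho < 1 ->
    (fun n => normH rho (g n - f)) @ \oo --> (0 : R).

Definition divH (g f : fps K) : Prop := exists h, inH h /\ f = g * h.

Definition unitH (w : fps K) : Prop :=
  inH w /\ exists w', inH w' /\ w * w' = 1.

Definition cstH (x : K) : fps K := fps_of_poly x%:P.

Definition omega (n : nat) : {poly K} := ('X + 1) ^+ (p ^ n) - 1.

Definition xi (n : nat) : {poly K} :=
  if n is n'.+1 then omega n %/ omega n' else p%:R *: 'X.

Definition twist (u : K) (j : int) (P : {poly K}) : {poly K} :=
  P \Po ((u ^ (- j))%:P * ('X + 1) - 1).

Definition itv (a b : int) : seq int :=
  if a < b then [seq a + (i.+1)%:Z | i <- iota 0 `|b - a|%N] else [::].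

Definition omegaS (u : K) (n : nat) (J : seq int) : {poly K} :=
  \prod_(j <- J) twist u j (omega n).

Definition ell0 (u : K) (J : seq int) : {poly K} :=
  \prod_(j <- J) (p%:R^-1 *: twist u j (xi 0)).

Definition xit_spec (u : K) (n : nat) (J' J : seq int) (P : {poly K}) : Prop :=
  (size P <= ((p - 1) * size J' + size J) * p ^ n.-1)%N /\
  (forall j, j \in J' -> twist u j (omega n) %| P - p%:R^-1 *: twist u j (xi n)) /\
  (forall j, j \in J -> j \notin J' -> twist u j (omega n.-1) %| P - 1).

Definition xit (u : K) (n : nat) (J' J : seq int) : {poly K} :=
  if n is 0 then ell0 u J'
  else epsilon (inhabits 0) (xit_spec u n J' J).

Definition XiLim (u : K) (N : nat) (J' J : seq int) (X : fps K) : Prop :=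
  inH X /\
  cvgH (fun M => fps_of_poly (\prod_(N <= m < M) xit u m J' J)) X.

(* D = Qp^d as row vectors; Fil i given by the row space of a matrix *)
Definition filtration (d : nat) (Fil : int -> 'M[K]_d) : Prop :=
  (forall i : int, (Fil (i + 1)%R <= Fil i)%MS) /\
  (exists i : int, row_full (Fil i)) /\
  (exists i : int, \rank (Fil i) = 0%N).

Definition HT_weights (d : nat) (Fil : int -> 'M[K]_d) (t : 'I_d -> int) :=
  (forall i j : 'I_d, (i <= j)%N -> t i <= t j) /\
  (forall w : int, #|[set k | t k == w]| = (\rank (Fil w) - \rank (Fil (w + 1)%R))%N).

Definition vp (x : L) : R := - ln (absC x) / ln p%:R.

(* lam lists the eigenvalues of phi (in Cp, with multiplicity), ordered by
   nondecreasing valuation; t_{N,k} = vp (lam k) *)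
Definition eigen_vals (d : nat) (phi : 'M[K]_d) (lam : 'I_d -> L) : Prop :=
  map_poly emb (char_poly phi) = \prod_(k < d) ('X - (lam k)%:P) /\
  (forall i j : 'I_d, (i <= j)%N -> vp (lam i) <= vp (lam j)).

Definition adapted_basis (d : nat) (Fil : int -> 'M[K]_d) (t : 'I_d -> int)
  (B : 'M[K]_d) : Prop :=
  B \in unitmx /\ forall i : 'I_d, (row i B <= Fil (t i))%MS.

Definition tprime_spec (t1 td : int) (Delta : R) (tp : int) : Prop :=
  td <= tp /\ Delta < (tp - t1)%:~R /\
  forall m : int, td <= m -> Delta < (m - t1)%:~R -> tp <= m.

(* Endomorphisms of H (x) D are matrices acting on row coordinate vectors
   (x |-> x *m M); thus the composite F o G has matrix G *m F. *)
Section Zdef.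
Variables (u : K) (d : nat) (phi B : 'M[K]_d) (t : 'I_d -> int) (td a b : int).

Definition Tmat (n : nat) : 'M[fps K]_d :=
  map_mx cstH (invmx B) *m
  diag_mx (\row_i fps_of_poly (xit u n (itv (t i) td) (itv a b))) *m
  map_mx cstH B.

Definition Zstep (n : nat) (M : 'M[fps K]_d) : 'M[fps K]_d :=
  M *m map_mx cstH (invmx phi ^+ n.+1) *m Tmat n *m map_mx cstH (phi ^+ n.+1).

(* Zseq N n = Z_n for n >= N, and = Id = Z_{N-1} for n < N *)
Fixpoint Zseq (N n : nat) : 'M[fps K]_d :=
  match n with
  | 0 => if N == 0%N then Zstep 0 1%:M else 1%:M
  | n'.+1 => if (n < N)%N then 1%:M else Zstep n (Zseq N n')
  end.
End Zdef.

End Padic.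

Definition ord_first (d : nat) (hd : (0 < d)%N) : 'I_d := Ordinal hd.
Definition ord_last (d : nat) (hd : (0 < d)%N) : 'I_d :=
  Ordinal (etrans (ltn_predL d) hd).

(* Main.v *)
Require Import Defs.
From HB Require Import structures.
From mathcomp Require Import all_boot all_order all_algebra.
From mathcomp Require Import all_classical all_reals all_analysis.
From mathcomp Require Import ring lra.
From Stdlib Require ClassicalEpsilon.
Import Order.TTheory GRing.Theory Num.Theory.
Import numFieldNormedType.Exports.
Local Open Scope classical_set_scope. Local Open Scope ring_scope.
Set Implicit Arguments. Unset Strict Implicit. Unset Printing Implicit Defensive.

(* Put v = u^(p^n) and Y = omega_n.  Then omega_n^(j) = v^(-j) (1 + Y) - 1 and
   xi_(n+1)^(j) = Phi_p(v^(-j) (1 + Y)), so the interpolation problem defining xit_(n+1) is the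
   substitution Y = omega_n in a problem of bounded degree.  Its solution is
   xit_(n+1) = 1 + omega_n^J G_n(omega_n), where G_n inverts a product of linear forms in Y modulo
   a product of cyclotomic factors and has coefficients bounded independently of n.

   The factor omega_n^J gives the congruence Z_(n+1) = Z_n at once.  On a disc of radius rho < 1,
   omega_n^J = O(p^(-n #|J|)), while phi^n = O(|lam_1|^n) and phi^(-n) = O(|lam_d|^(-n)); as
   #|J| > t_(N,d) - t_(N,1), the factors conj(T_n) tend geometrically to the identity and the
   Z_n converge.  Conjugation does not change determinants, so det Z_n is exactly the product of
   the partial products of the Xi_k, and the unit is 1. *)

(** * Ultrametric absolute values and Gauss bounds *)

(** The analysis is done with coefficient bounds |f_i| rho^i <= C, that is with Gauss norms: they
    are submultiplicative by the ultrametric inequality, they can be handled over Q_p without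
    evaluating at points of C_p, and they dominate the sup norms in which convergence is stated. The
    delicate point is the uniformity of the bound on G_n. Inverting a linear form modulo a product
    of cyclotomic factors costs the inverse of the value of that product at the root of the form.
    Each factor takes there a value of Phi_p at a principal unit, of absolute value exactly 1/p at
    every level because p is odd. With #|J'| cyclotomic factors and #|J| linear forms the total cost
    is p^(#|J'| #|J|). As [xit] is picked by [epsilon] from its specification, the explicit solution
    has to be matched with it by uniqueness. This rests on the coprimality of the twists of omega_n,
    hence on the absence of torsion among principal units. *)

Record ultra_abs (R : realType) (F : fieldType) (ab : F -> R) : Prop := UltraAbs {
  uabs_eq0 : forall x, (ab x == 0) = (x == 0);
  uabs_ge0 : forall x, 0 <= ab x;
  uabsM : forall x y, ab (x * y) = ab x * ab y;
  uabsD : forall x y, ab (x + y) <= Num.max (ab x) (ab y) }.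

Section UltrametricAbs.
Variables (R : realType) (F : fieldType) (ab : F -> R).
Hypothesis hab : ultra_abs ab.

Lemma uabs0 : ab 0 = 0.
Proof. by apply/eqP; rewrite (uabs_eq0 hab). Qed.

Lemma uabs1 : ab 1 = 1.
Proof.
have n0 : ab 1 != 0 by rewrite (uabs_eq0 hab) oner_eq0.
by apply: (mulfI n0); rewrite -(uabsM hab) !mulr1.
Qed.

Lemma uabsX x n : ab (x ^+ n) = ab x ^+ n.
Proof. by elim: n => [|n IH]; rewrite ?expr0 ?uabs1 // !exprS (uabsM hab) IH. Qed.

Lemma uabsN x : ab (- x) = ab x.
Proof.
have h1 : ab (-1) = 1.
  have : ab (-1) ^+ 2 == 1 by rewrite -uabsX sqrrN expr1n uabs1.
  rewrite sqrf_eq1 => /orP[/eqP//|/eqP h].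
  by have := uabs_ge0 hab (-1); rewrite h lerNr oppr0 ler10.
by rewrite -mulN1r (uabsM hab) h1 mul1r.
Qed.

Lemma uabsV x : ab x^-1 = (ab x)^-1.
Proof.
have [->|x0] := eqVneq x 0; first by rewrite invr0 uabs0 invr0.
have n0 : ab x != 0 by rewrite (uabs_eq0 hab).
by apply: (mulfI n0); rewrite -(uabsM hab) !divff // uabs1.
Qed.

Lemma uabs_gt0 x : (0 < ab x) = (x != 0).
Proof. by rewrite lt_def (uabs_ge0 hab) andbT (uabs_eq0 hab). Qed.

Lemma uabsD_le C x y : ab x <= C -> ab y <= C -> ab (x + y) <= C.
Proof. by move=> hx hy; apply: le_trans (uabsD hab _ _) _; rewrite ge_max hx. Qed.

Lemma uabs_sum_le (I : Type) (r : seq I) (P : pred I) (E : I -> F) C :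
  0 <= C -> (forall i, P i -> ab (E i) <= C) -> ab (\sum_(i <- r | P i) E i) <= C.
Proof.
move=> C0 h; elim/big_ind: _ => //; first by rewrite uabs0.
by move=> x y; apply: uabsD_le.
Qed.

Lemma uabs_nat n : ab n%:R <= 1.
Proof. by elim: n => [|n IH]; rewrite ?uabs0 // -natr1 uabsD_le // uabs1. Qed.

(** Isosceles triangles: were x smaller than y, then y = x - (x - y) would be smaller than
    itself. *)
Lemma uabs_dominant x y : ab (x - y) < ab y -> ab x = ab y.
Proof.
move=> h; apply/eqP; rewrite eq_le; apply/andP; split.
  by rewrite -(subrK y x) uabsD_le // ltW.
rewrite leNgt; apply/negP => lt_xy.
suff : ab y < ab y by rewrite ltxx.
rewrite -[y in X in X < _](subKr x) -opprB uabsN.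
by apply: le_lt_trans (uabsD hab _ _) _; rewrite uabsN gt_max h.
Qed.

Lemma uabs_prod (I : Type) (r : seq I) (P : pred I) (E : I -> F) :
  ab (\prod_(i <- r | P i) E i) = \prod_(i <- r | P i) ab (E i).
Proof. by apply: (big_morph ab (uabsM hab) uabs1). Qed.

Lemma uabs_exp_sub1_le w n r : ab w <= 1 -> ab (w - 1) <= r -> ab (w ^+ n - 1) <= r.
Proof.
move=> w1 hw; rewrite subrX1 (uabsM hab).
apply: le_trans hw; apply: ler_piMr; first exact: uabs_ge0 hab _.
by apply: uabs_sum_le => // i _; rewrite uabsX exprn_ile1 ?(uabs_ge0 hab).
Qed.

End UltrametricAbs.

(** First-order expansion of (w^n - 1)/(w - 1) at w = 1 + f: the constant n plus a multiple of f.
    For n = p it yields both the contraction of omega_n and the congruence of the cyclotomic factors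
    with p modulo the linear ones. *)
Lemma sum_exp1D (A : comNzRingType) (f : A) n :
  \sum_(k < n) (1 + f) ^+ k = n%:R + f * \sum_(k < n) \sum_(i < k) (1 + f) ^+ i.
Proof.
rewrite mulr_sumr -[n in n%:R]card_ord -sumr_const -big_split /=.
by apply: eq_bigr => k _; rewrite -[f in f * _](addKr 1) [- 1 + _]addrC -subrX1 addrC subrK.
Qed.

Section GaussBound.
Variables (R : realType) (F : fieldType) (ab : F -> R).
Hypothesis hab : ultra_abs ab.

(** A bound on the Gauss norm over the disc of radius [rho], kept as a predicate so that no supremum
    has to be shown finite. *)
Definition gbd (rho C : R) (f : fps F) : Prop := forall i, ab (f i) * rho ^+ i <= C.

Variable rho : R.
Hypothesis rho0 : 0 <= rho.
Implicit Types (f g : fps F) (C D : R).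

Lemma gbd_ge0 C f : gbd rho C f -> 0 <= C.
Proof. by move=> h; apply: le_trans (h 0%N); rewrite expr0 mulr1 (uabs_ge0 hab). Qed.

Lemma gbd_le C D f : C <= D -> gbd rho C f -> gbd rho D f.
Proof. by move=> CD h i; apply: le_trans (h i) CD. Qed.

Lemma gbd0 C : 0 <= C -> gbd rho C 0.
Proof. by move=> C0 i; rewrite (uabs0 hab) mul0r. Qed.

Lemma gbdD C f g : gbd rho C f -> gbd rho C g -> gbd rho C (f + g).
Proof.
move=> hf hg i; rewrite fps_addE.
apply: le_trans (ler_wpM2r (exprn_ge0 i rho0) (uabsD hab _ _)) _.
by rewrite maxr_pMl ?exprn_ge0 // ge_max hf hg.
Qed.

Lemma gbdN C f : gbd rho C f -> gbd rho C (- f).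
Proof. by move=> hf i; rewrite (uabsN hab). Qed.

Lemma gbdB C f g : gbd rho C f -> gbd rho C g -> gbd rho C (f - g).
Proof. by move=> hf hg; apply: gbdD => //; apply: gbdN. Qed.

Lemma gbd_sum (I : Type) (r : seq I) (P : pred I) (E : I -> fps F) C :
  0 <= C -> (forall i, P i -> gbd rho C (E i)) -> gbd rho C (\sum_(i <- r | P i) E i).
Proof. by move=> C0 h; elim/big_ind: _ => //; [exact: gbd0|move=> x y; apply: gbdD]. Qed.

Lemma fps_mulE f g n : (f * g) n = \sum_(i < n.+1) f i * g (n - i)%N.
Proof. by []. Qed.

Lemma gbdM C D f g : gbd rho C f -> gbd rho D g -> gbd rho (C * D) (f * g).
Proof.
move=> hf hg n; rewrite fps_mulE.
have [->|r0] := eqVneq rho 0.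
  case: n => [|n]; last by rewrite expr0n mulr0 mulr_ge0 ?(gbd_ge0 hf) ?(gbd_ge0 hg).
  rewrite big_ord_recl big_ord0 addr0 expr0 mulr1 (uabsM hab) subnn.
  have := hf 0%N; have := hg 0%N; rewrite !expr0 !mulr1 => h1 h2.
  by apply: ler_pM => //; apply: (uabs_ge0 hab).
have rp : 0 < rho by rewrite lt_def r0.
rewrite -ler_pdivlMr ?exprn_gt0 //.
apply: (uabs_sum_le hab).
  by rewrite divr_ge0 ?exprn_ge0 ?mulr_ge0 ?(gbd_ge0 hf) ?(gbd_ge0 hg).
move=> i _; rewrite ler_pdivlMr ?exprn_gt0 // (uabsM hab).
have le_in : (i <= n)%N by rewrite -ltnS.
rewrite -[in rho ^+ n](subnKC le_in) exprD mulrACA.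
apply: ler_pM => //; apply: mulr_ge0; rewrite ?exprn_ge0 ?(uabs_ge0 hab) //.
Qed.

Lemma fps1E i : (1 : fps F) i = (i == 0%N)%:R.
Proof. by []. Qed.

Lemma gbd1 : gbd rho 1 1.
Proof.
by case=> [|i]; rewrite fps1E /= ?(uabs1 hab) ?(uabs0 hab) ?mul0r // expr0 mulr1.
Qed.

Lemma gbdX C f n : gbd rho C f -> gbd rho (C ^+ n) (f ^+ n).
Proof.
by move=> h; elim: n => [|n IH]; [exact: gbd1|rewrite !exprS; apply: gbdM].
Qed.

Lemma gbd_prod (I : Type) (r : seq I) (E : I -> fps F) C :
  (forall i, gbd rho C (E i)) -> gbd rho (C ^+ size r) (\prod_(i <- r) E i).
Proof.
move=> h; elim: r => [|x r IH]; first by rewrite big_nil; apply: gbd1.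
by rewrite big_cons exprS; apply: gbdM.
Qed.

Lemma fps_of_poly_additive : zmod_morphism (@fps_of_poly F).
Proof. by move=> P Q; apply: funext => i; rewrite /fps_of_poly coefB. Qed.

Lemma fps_of_poly_multiplicative : monoid_morphism (@fps_of_poly F).
Proof.
split=> [|P Q]; apply: funext => i; first by rewrite /fps_of_poly coef1.
by rewrite /fps_of_poly coefM.
Qed.

HB.instance Definition _ := GRing.isZmodMorphism.Build {poly F} (fps F)
  (@fps_of_poly F) fps_of_poly_additive.
HB.instance Definition _ := GRing.isMonoidMorphism.Build {poly F} (fps F)
  (@fps_of_poly F) fps_of_poly_multiplicative.

Lemma gbd_polyC c : gbd rho (ab c) (fps_of_poly c%:P).
Proof.
case=> [|i]; rewrite /fps_of_poly coefC /= ?expr0 ?mulr1 //.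
by rewrite (uabs0 hab) mul0r (uabs_ge0 hab).
Qed.

Lemma gbdZ C c P : gbd rho C (fps_of_poly P) ->
  gbd rho (ab c * C) (fps_of_poly (c *: P)).
Proof. by move=> h; rewrite -mul_polyC rmorphM; apply: gbdM => //; apply: gbd_polyC. Qed.

Lemma gbd_polyX : gbd rho rho (fps_of_poly 'X).
Proof.
case=> [|[|i]]; rewrite /fps_of_poly coefX /= ?(uabs1 hab) ?(uabs0 hab) ?mul0r //.
by rewrite mul1r expr1.
Qed.

(** Meant for Q = omega_n: a polynomial in omega_n inherits the coefficient bound of the polynomial,
    whatever n. *)
Lemma gbd_comp C P Q : gbd 1 C (fps_of_poly P) -> gbd rho 1 (fps_of_poly Q) ->
  gbd rho C (fps_of_poly (P \Po Q)).
Proof.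
move=> hP hQ; rewrite comp_polyE raddf_sum; apply: gbd_sum => [|i _].
  by apply: le_trans (hP 0%N); rewrite expr0 mulr1 (uabs_ge0 hab).
rewrite /= -[C]mulr1; apply: (gbd_le (C := ab P`_i * 1)).
  by rewrite !mulr1; have := hP i; rewrite expr1n mulr1.
by apply: gbdZ; rewrite rmorphXn /= -[1](expr1n _ i); apply: gbdX.
Qed.

Lemma gbd_poly_ex P : exists C, gbd rho C (fps_of_poly P).
Proof.
exists (\sum_(i < size P) ab P`_i * rho ^+ i) => i.
have nn (j : nat) : 0 <= ab P`_j * rho ^+ j by rewrite mulr_ge0 ?exprn_ge0 ?(uabs_ge0 hab).
have [si|si] := ltnP i (size P).
  by rewrite (bigD1 (Ordinal si)) //= lerDl sumr_ge0.
by rewrite /fps_of_poly nth_default // (uabs0 hab) mul0r sumr_ge0.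
Qed.

Lemma gbd_sum_exp1D r f n : gbd rho r f -> r <= 1 ->
  gbd rho (Num.max (ab n%:R) r) (\sum_(k < n) (1 + f) ^+ k).
Proof.
move=> hf r1.
have h1 : gbd rho 1 (1 + f) by apply: gbdD; [exact: gbd1|exact: gbd_le hf].
rewrite sum_exp1D -(rmorph_nat (@fps_of_poly F)) -polyC_natr; apply: gbdD.
  by apply: gbd_le (gbd_polyC _); rewrite le_max lexx.
apply: (gbd_le (C := r * 1)); first by rewrite mulr1 le_max lexx orbT.
apply: gbdM => //; apply: gbd_sum => // k _; apply: gbd_sum => // i _.
by rewrite -[1](expr1n _ i); apply: gbdX.
Qed.

Lemma gbd_polyE C P : gbd 1 C (fps_of_poly P) <-> forall i, ab P`_i <= C.
Proof. by split=> h i; have := h i; rewrite expr1n mulr1. Qed.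

End GaussBound.

(** * Power series bounded on every smaller disc *)

Section QpSettingTheory.
Variables (R : realType) (p : nat) (S : QpSetting R p).
Local Notation K := (Qp S).
Local Notation L := (Cp S).
Local Notation emb := (@emb _ _ S).
Local Notation absC := (@absC _ _ S).
Local Notation absQ := (@absQ _ _ S).
Local Notation gb := (gbd absQ).

Lemma ultra_absC : ultra_abs absC.
Proof. by split; [exact: absC_eq0|exact: absC_ge0|exact: absCM|exact: absC_ultra]. Qed.

Lemma ultra_absQ : ultra_abs absQ.
Proof.
split=> [x|x|x y|x y]; rewrite /Defs.absQ ?absC_eq0 ?fmorph_eq0 ?absC_ge0 //.
  by rewrite rmorphM absCM.
by rewrite rmorphD absC_ultra.
Qed.

Lemma absQ_p : absQ p%:R = p%:R^-1.
Proof. by rewrite /Defs.absQ rmorph_nat absC_p. Qed.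

(** Coefficient form of membership in H; sums, products and limits preserve it by direct
    estimates. *)
Definition inG (f : fps K) : Prop :=
  forall rho : R, 0 < rho < 1 -> exists C, gb rho C f.

Definition cvgG (g : nat -> fps K) (f : fps K) : Prop :=
  forall rho : R, 0 < rho < 1 -> forall e : R, 0 < e ->
    exists M : nat, forall n, (M <= n)%N -> gb rho e (g n - f).

(** Consecutive differences are enough: by the ultrametric inequality they bound all later ones
    ([cauchyG_tail]). *)
Definition cauchyG (g : nat -> fps K) : Prop :=
  forall rho : R, 0 < rho < 1 -> forall e : R, 0 < e ->
    exists M : nat, forall n, (M <= n)%N -> gb rho e (g n.+1 - g n).

Lemma inG_poly P : inG (fps_of_poly P).
Proof. by move=> rho /andP[/ltW r0 _]; exact: (gbd_poly_ex ultra_absQ r0). Qed.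

Lemma inGD f g : inG f -> inG g -> inG (f + g).
Proof.
move=> hf hg rho hr; have [C hC] := hf _ hr; have [D hD] := hg _ hr.
exists (Num.max C D); apply: (gbdD ultra_absQ); first by case/andP: hr => /ltW.
  by apply: gbd_le hC; rewrite le_max lexx.
by apply: gbd_le hD; rewrite le_max lexx orbT.
Qed.

Lemma inGM f g : inG f -> inG g -> inG (f * g).
Proof.
move=> hf hg rho hr; have [C hC] := hf _ hr; have [D hD] := hg _ hr.
by exists (C * D); apply: (gbdM ultra_absQ) => //; case/andP: hr => /ltW.
Qed.

Lemma inG_sum (I : Type) (r : seq I) (P : pred I) (E : I -> fps K) :
  (forall i, P i -> inG (E i)) -> inG (\sum_(i <- r | P i) E i).
Proof.
move=> h; elim/big_ind: _ => //; last exact: inGD.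
by rewrite -[0](rmorph0 (@fps_of_poly K)); apply: inG_poly.
Qed.

Lemma geometric_small (q r e : R) : 0 <= q < 1 -> 0 < e ->
  exists M, forall n, (M <= n)%N -> r * q ^+ n <= e.
Proof.
move=> /andP[q0 q1] e0.
have h : (fun n => r * q ^+ n) @ \oo --> r * 0.
  by apply: cvgM; [exact: cvg_cst|apply: cvg_expr; rewrite ger0_norm].
rewrite mulr0 in h.
have [M _ hM] := cvgr0_norm_le _ h _ e0.
by exists M => n Mn; apply: le_trans (ler_norm _) _; apply: hM.
Qed.

Lemma psum_term_le (rho C : R) (f : fps K) z (i : nat) : 0 <= rho ->
  gb rho C f -> absC z <= rho -> absC (emb (f i) * z ^+ i) <= C.
Proof.
move=> r0 hf hz; apply: le_trans (hf i); rewrite absCM (uabsX ultra_absC).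
by apply: ler_wpM2l; [exact: absC_ge0|apply: lerXn2r; rewrite ?nnegrE ?absC_ge0].
Qed.

Lemma psum_le (rho C : R) (f : fps K) z n : 0 <= rho ->
  gb rho C f -> absC z <= rho -> absC (psum f z n) <= C.
Proof.
move=> r0 hf hz; apply: (uabs_sum_le ultra_absC) => [|i _].
  exact: (gbd_ge0 ultra_absQ hf).
exact: (psum_term_le i r0 hf hz).
Qed.

Lemma psumB (f : fps K) z m n : (m <= n)%N ->
  psum f z n - psum f z m = \sum_(m <= i < n) emb (f i) * z ^+ i.
Proof.
move=> mn; rewrite /psum -!(big_mkord xpredT (fun i => emb (f i) * z ^+ i)).
rewrite (big_cat_nat (n := m)) //=. by rewrite addrAC subrr add0r.
Qed.

Lemma inG_inH f : inG f -> inH f.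
Proof.
move=> hf z z1.
(* At a radius strictly between |z| and 1, the terms of the series are at most C (|z| / rho)^i. *)
pose rho := (absC z + 1) / 2.
have z0 : 0 <= absC z := absC_ge0 _.
have hr : 0 < rho < 1 by rewrite /rho; apply/andP; split; lra.
have zr : absC z < rho by rewrite /rho; lra.
have [C hC] := hf _ hr.
have r0 : 0 < rho by case/andP: hr.
apply: Cp_complete => e e0.
have hq : 0 <= absC z / rho < 1.
  by rewrite divr_ge0 ?(ltW r0) //= ltr_pdivrMr // mul1r.
have [M hM] := geometric_small C hq (divr_gt0 e0 (ltr0n _ 2)).
have key m n : (M <= m)%N -> (m <= n)%N -> absC (psum f z n - psum f z m) < e.
  move=> Mm mn; rewrite psumB //.
  apply: (@le_lt_trans _ _ (e / 2)); last by lra.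
  rewrite big_nat; apply: (uabs_sum_le ultra_absC) => [|i /andP[mi _]].
    by rewrite divr_ge0 // ltW.
  apply: le_trans (hM i (leq_trans Mm mi)).
  rewrite absCM (uabsX ultra_absC) expr_div_n mulrA ler_pdivlMr ?exprn_gt0 // mulrAC.
  by apply: ler_wpM2r; rewrite ?exprn_ge0 //; exact: hC.
exists M => m n Mm Mn; case: (leqP m n) => [mn|/ltnW nm].
  by rewrite -(uabsN ultra_absC) opprB key.
exact: key.
Qed.

(** If |l| exceeded C it would be positive, and then |s_n| = |l| for large n by [uabs_dominant]. *)
Lemma cvg_abs_le s l C (n0 : nat) : (forall n, (n0 <= n)%N -> absC (s n) <= C) ->
  cvg_abs absC s l -> absC l <= C.
Proof.
move=> hs hl; rewrite leNgt; apply/negP => ltC.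
have C0 : 0 <= C := le_trans (absC_ge0 (s n0)) (hs n0 (leqnn _)).
have lp : 0 < absC l by apply: le_lt_trans ltC.
have [M _ hM] := cvgr0_norm_lt _ hl _ lp.
have hn := hM (maxn M n0) (leq_maxl _ _).
rewrite /= ger0_norm ?absC_ge0 // in hn.
have := uabs_dominant ultra_absC hn => e.
by have := hs (maxn M n0) (leq_maxr _ _); rewrite e leNgt ltC.
Qed.

Lemma cvg_abs_cst x : cvg_abs absC (fun=> x) x.
Proof. by rewrite /cvg_abs subrr (uabs0 ultra_absC); apply: cvg_cst. Qed.

Lemma normH_le (rho C : R) (f : fps K) : 0 < rho -> gb rho C f -> 0 <= normH rho f <= C.
Proof.
move=> r0 hf; rewrite /normH; set A := [set r | _].
have ubA : ubound A C.
  move=> r [z [l [hz [hl ->]]]]; apply: (cvg_abs_le (n0 := 0%N) _ hl) => n _.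
  exact: (psum_le n (ltW r0) hf hz).
(* The value at z = 0 makes the set nonempty, without which [sup] would say nothing about it. *)
have inA : A (absC (emb (f 0%N))).
  exists 0, (emb (f 0%N)); split; first by rewrite (uabs0 ultra_absC) ltW.
  (* The partial sum of index 0 is empty, so the sequence is constant only from index 1 on. *)
  split=> //; rewrite /cvg_abs -cvg_shiftS /=.
  rewrite [X in X @ _](_ : _ = fun=> absC (emb (f 0%N) - emb (f 0%N))).
    exact: cvg_abs_cst.
  apply: funext => n; rewrite /psum big_ord_recl /= expr0 mulr1 big1 ?addr0 // => i _.
  by rewrite exprS mul0r mulr0.
apply/andP; split; last by apply: ge_sup => //; exists (absC (emb (f 0%N))).
apply: le_trans (absC_ge0 (emb (f 0%N))) _; apply: ub_le_sup => //.
by exists C.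
Qed.

Lemma cvgG_cvgH g f : cvgG g f -> cvgH g f.
Proof.
move=> h rho hr; apply/cvgr0Pnorm_le => e e0.
have [M hM] := h _ hr _ e0.
exists M => // n /= Mn; case/andP: hr => r0 _.
by have /andP[h0 h1] := normH_le r0 (hM n Mn); rewrite ger0_norm.
Qed.

Lemma cvgG_unique g f f' : cvgG g f -> cvgG g f' -> f = f'.
Proof.
move=> h h'; apply: funext => i; apply/eqP; rewrite -subr_eq0 -(uabs_eq0 ultra_absQ).
have hr : 0 < (2^-1 : R) < 1 by apply/andP; split; lra.
have r0 : 0 < (2^-1 : R) by case/andP: hr.
rewrite eq_le (uabs_ge0 ultra_absQ) andbT; apply/ler_addgt0Pr => e e0; rewrite add0r.
have e' : 0 < e * 2^-1 ^+ i by rewrite mulr_gt0 ?exprn_gt0.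
have [M hM] := h _ hr _ e'; have [M' hM'] := h' _ hr _ e'.
have h1 := hM _ (leq_maxl M M'); have h2 := hM' _ (leq_maxr M M').
have := gbdB ultra_absQ (ltW r0) h2 h1 i.
have -> : g (maxn M M') - f' - (g (maxn M M') - f) = f - f' by ring.
by rewrite ler_pM2r ?exprn_gt0.
Qed.

Lemma inG_cvgG g f : (forall n, inG (g n)) -> cvgG g f -> inG f.
Proof.
move=> hg h rho hr; have [M hM] := h _ hr _ ltr01; have [C hC] := hg M _ hr.
exists (Num.max C 1); rewrite -[f](subKr (g M)).
apply: (gbdB ultra_absQ); first by case/andP: hr => /ltW.
  by apply: gbd_le hC; rewrite le_max lexx.
by apply: gbd_le (hM M (leqnn _)); rewrite le_max lexx orbT.
Qed.

Lemma cvgGD g f g' f' : cvgG g f -> cvgG g' f' -> cvgG (fun n => g n + g' n) (f + f').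
Proof.
move=> h h' rho hr e e0; have [M hM] := h _ hr _ e0; have [M' hM'] := h' _ hr _ e0.
exists (maxn M M') => n; rewrite geq_max => /andP[h1 h2].
rewrite opprD addrACA; apply: (gbdD ultra_absQ); [by case/andP: hr => /ltW| |].
  exact: hM.
exact: hM'.
Qed.

Lemma cvgG_cst f : cvgG (fun=> f) f.
Proof.
move=> rho hr e e0; exists 0%N => n _; rewrite subrr.
by apply: (gbd0 ultra_absQ); exact: ltW.
Qed.

Lemma cvgGM g f g' f' : inG f -> inG f' ->
  cvgG g f -> cvgG g' f' -> cvgG (fun n => g n * g' n) (f * f').
Proof.
move=> bf bf' h h' rho hr e e0; have r0 : 0 <= rho by case/andP: hr => /ltW.
have [C hC] := bf _ hr; have [C' hC'] := bf' _ hr.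
have C0 := gbd_ge0 ultra_absQ hC; have C'0 := gbd_ge0 ultra_absQ hC'.
(* D dominates f' and, once g n is within 1 of f, also g n; the summand 1 keeps it positive. *)
pose D := 1 + C + C'.
have D0 : 0 < D by rewrite /D; lra.
have [M hM] := h _ hr _ (divr_gt0 e0 D0).
have [M1 hM1] := h _ hr _ ltr01.
have [M' hM'] := h' _ hr _ (divr_gt0 e0 D0).
exists (maxn (maxn M M1) M') => n; rewrite !geq_max => /andP[/andP[a1 a2] a3].
have -> : g n * g' n - f * f' = g n * (g' n - f') + (g n - f) * f' by ring.
have bg : gb rho D (g n).
  rewrite -(subrK f (g n)); apply: (gbdD ultra_absQ) => //.
    by apply: gbd_le (hM1 n a2); rewrite /D; lra.
  by apply: gbd_le hC; rewrite /D; lra.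
have -> : e = D * (e / D) by rewrite mulrC divfK ?gt_eqF.
apply: (gbdD ultra_absQ) => //; first by apply: (gbdM ultra_absQ) => //; exact: hM'.
rewrite [D * _]mulrC; apply: (gbdM ultra_absQ) => //; first exact: hM.
by apply: gbd_le hC'; rewrite /D; lra.
Qed.

Lemma cvgG_sum (I : Type) (r : seq I) (g : I -> nat -> fps K) (f : I -> fps K) :
  (forall i, cvgG (g i) (f i)) ->
  cvgG (fun n => \sum_(i <- r) g i n) (\sum_(i <- r) f i).
Proof.
move=> h; elim: r => [|x r IH].
  by rewrite big_nil; under eq_fun do rewrite big_nil; exact: cvgG_cst.
by rewrite big_cons; under eq_fun do rewrite big_cons; exact: cvgGD.
Qed.

Lemma cvgG_prod (I : Type) (r : seq I) (g : I -> nat -> fps K) (f : I -> fps K) :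
  (forall i, inG (f i)) -> (forall i, cvgG (g i) (f i)) ->
  cvgG (fun n => \prod_(i <- r) g i n) (\prod_(i <- r) f i).
Proof.
move=> bf h; elim: r => [|x r IH].
  by rewrite big_nil; under eq_fun do rewrite big_nil; exact: cvgG_cst.
rewrite big_cons; under eq_fun do rewrite big_cons; apply: cvgGM => //.
elim: r {IH} => [|y r IH]; last by rewrite big_cons; apply: inGM.
by rewrite big_nil -[1](rmorph1 (@fps_of_poly K)); apply: inG_poly.
Qed.

Lemma cauchyG_tail g (rho e : R) M : 0 < rho -> 0 <= e ->
  (forall n, (M <= n)%N -> gb rho e (g n.+1 - g n)) ->
  forall m n, (M <= m)%N -> (m <= n)%N -> gb rho e (g n - g m).
Proof.
move=> r0 e0 hM m n Mm; elim: n => [|n IH].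
  by rewrite leqn0 => /eqP ->; rewrite subrr; apply: (gbd0 ultra_absQ).
rewrite leq_eqVlt => /orP[/eqP->|mn]; first by rewrite subrr; apply: (gbd0 ultra_absQ).
rewrite -(subrKA (g n)); apply: (gbdD ultra_absQ (ltW r0)); last exact: IH.
exact: (hM _ (leq_trans Mm mn)).
Qed.

(** Limits are taken coefficient by coefficient in Q_p. The threshold M does not depend on the
    coefficient, so the tail bound passes to the limit at all indices at once. *)
Lemma cauchyG_cvgG g : cauchyG g -> exists f, cvgG g f.
Proof.
move=> h.
have cv i : exists l, cvg_abs absC (fun n => emb (g n i)) (emb l).
  apply: Qp_complete => e e0.
  have hr : 0 < (2^-1 : R) < 1 by apply/andP; split; lra.
  have r0 : 0 < (2^-1 : R) by case/andP: hr.
  have e' : 0 < e / 2 * 2^-1 ^+ i by rewrite mulr_gt0 ?exprn_gt0 //; lra.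
  have [M hM] := h _ hr _ e'; exists M.
  have key m n : (M <= m)%N -> (m <= n)%N -> absC (emb (g n i) - emb (g m i)) < e.
    move=> Mm mn; have := cauchyG_tail r0 (ltW e') hM Mm mn i.
    rewrite ler_pM2r ?exprn_gt0 // /Defs.absQ => hh.
    by rewrite -rmorphB; apply: le_lt_trans hh _; lra.
  move=> m n Mm Mn; case: (leqP m n) => [mn|/ltnW nm].
    by rewrite -(uabsN ultra_absC) opprB key.
  exact: key.
pose f : fps K := fun i => projT1 (cid (cv i)).
have hf i : cvg_abs absC (fun n => emb (g n i)) (emb (f i)) := projT2 (cid (cv i)).
exists f => rho hr e e0; have r0 : 0 < rho by case/andP: hr.
have [M hM] := h _ hr _ e0; exists M => m Mm i.
have rp : 0 < rho ^+ i by rewrite exprn_gt0.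
rewrite -ler_pdivlMr //.
have hs : cvg_abs absC (fun n => emb (g m i - g n i)) (emb (g m i - f i)).
  rewrite /cvg_abs (_ : (fun n => _) = fun n => absC (emb (g n i) - emb (f i))).
    exact: hf.
  apply: funext => n; rewrite -(uabsN ultra_absC) -!rmorphB -rmorphN.
  by congr (absC (emb _)); ring.
apply: (cvg_abs_le (n0 := m) _ hs) => n mn; rewrite ler_pdivlMr //.
have := gbdN ultra_absQ (cauchyG_tail r0 (ltW e0) hM Mm mn) i.
by rewrite opprB.
Qed.

End QpSettingTheory.

(** * Bounded inverses modulo a polynomial *)

Section GaussDivision.
Variables (R : realType) (F : fieldType) (ab : F -> R).
Hypothesis hab : ultra_abs ab.
Local Notation gb1 C P := (gbd ab 1 C (fps_of_poly P)).

(** The twist by j of omega_n is this polynomial evaluated at omega_n, with a = v^(-j)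
    ([twist_omega]). *)
Definition lin (a : F) : {poly F} := a%:P * ('X + 1) - 1.

Lemma gbd_horner (C : R) P c : ab c <= 1 -> gb1 C P -> ab P.[c] <= C.
Proof.
move=> c1 /gbd_polyE hP; rewrite horner_coef.
apply: (uabs_sum_le hab) => [|i _]; first exact: le_trans (uabs_ge0 hab _) (hP 0%N).
rewrite (uabsM hab) (uabsX hab); apply: le_trans (hP i).
by rewrite ler_piMr ?(uabs_ge0 hab) // exprn_ile1 ?(uabs_ge0 hab).
Qed.

(* If P = Q (X - c), the coefficients of Q are determined from the top down by
   Q_k = P_(k+1) + c Q_(k+1). *)
Lemma gbd_divXsubC (C : R) Q c : ab c <= 1 -> gb1 C (Q * ('X - c%:P)) -> gb1 C Q.
Proof.
move=> c1 /gbd_polyE hP; apply/gbd_polyE.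
have C0 : 0 <= C := le_trans (uabs_ge0 hab _) (hP 0%N).
have step k : ab Q`_k.+1 <= C -> ab Q`_k <= C.
  move=> hk; have := hP k.+1; rewrite mulrBr coefB coefMX coefMC /= => hP1.
  rewrite -(subrK (Q`_k.+1 * c) Q`_k); apply: (uabsD_le hab) => //.
  rewrite (uabsM hab); apply: le_trans hk.
  by rewrite ler_piMr ?(uabs_ge0 hab).
have top k m : (size Q <= k + m)%N -> ab Q`_k <= C.
  elim: m k => [|m IH] k; first by rewrite addn0 => h; rewrite nth_default ?(uabs0 hab).
  by rewrite addnS -addSn => /IH; apply: step.
by move=> i; apply: (top i (size Q)); rewrite leq_addl.
Qed.

Lemma linE a : a != 0 -> lin a = a *: ('X - (a^-1 - 1)%:P).
Proof.
move=> a0; rewrite /lin -mul_polyC polyCB mulrBr mulrBr -polyCM mulfV //.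
by rewrite mulrDr polyC1; ring.
Qed.

(** A multiple of D is subtracted from G to make it vanish at the root of [lin a], after which the
    division is exact. Only the quotient by the value of D at this root enlarges the
    coefficients. *)
Lemma inv_lin_mod (C delta : R) D G a : ab a = 1 -> ab (a - 1) <= 1 -> 0 < delta <= 1 ->
  delta <= ab D.[a^-1 - 1] -> gb1 1 D -> gb1 C G -> (size G <= (size D).-1)%N ->
  exists G1 : {poly F}, [/\ (size G1 <= (size D).-1)%N, D %| lin a * G1 - G & gb1 (C / delta) G1].
Proof.
move=> a1 ha1 /andP[d0 d1] hD gD gG sG; set c := a^-1 - 1 in hD.
have a0 : a != 0 by rewrite -(uabs_eq0 hab) a1 oner_eq0.
have c1 : ab c <= 1.
  have -> : c = - (a^-1 * (a - 1)) by rewrite /c mulrBr mulVf // mulr1 opprB.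
  by rewrite (uabsN hab) (uabsM hab) (uabsV hab) a1 invr1 mul1r.
have Dc0 : D.[c] != 0 by rewrite -(uabs_gt0 hab); apply: lt_le_trans hD.
have D0 : D != 0 by apply: contraNneq Dc0 => ->; rewrite horner0.
pose k := G.[c] / D.[c]; pose H := G - k *: D.
have rH : root H c by rewrite /root /H !hornerE /k divfK // subrr.
have [Q HQ] := factor_theorem _ _ rH.
have C0 : 0 <= C by apply: le_trans (uabs_ge0 hab (G.[c])) (gbd_horner c1 gG).
have CC : C <= C / delta by rewrite ler_pdivlMr // ler_piMr.
have gH : gb1 (C / delta) H.
  rewrite /H rmorphB; apply: (gbdB hab ler01); first exact: gbd_le gG.
  apply: (gbd_le (C := ab k * 1)); last exact: (gbdZ hab ler01 _ gD).
  rewrite mulr1 /k (uabsM hab) (uabsV hab).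
  apply: ler_pM => //; rewrite ?invr_ge0 ?(uabs_ge0 hab) //; first exact: gbd_horner.
  by rewrite lef_pV2 // posrE ?(uabs_gt0 hab).
exists (a^-1 *: Q); split.
- apply: leq_trans (size_scale_leq _ _) _.
  have [->|Q0] := eqVneq Q 0; first by rewrite size_poly0.
  have sH : size H = (size Q).+1 by rewrite HQ size_Mmonic ?monicXsubC // size_XsubC addn2.
  rewrite -ltnS -sH prednK ?size_poly_gt0 //.
  apply: leq_trans (size_polyD _ _) _; rewrite size_polyN geq_max.
  by rewrite (leq_trans sG (leq_pred _)) size_scale_leq.
- rewrite linE // -scalerAl -scalerAr scalerA mulfV // scale1r mulrC -HQ /H.
  by rewrite addrAC subrr add0r -mul_polyC -mulNr dvdp_mull.
- have gQ : gb1 (C / delta) Q by apply: (gbd_divXsubC c1); rewrite -HQ.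
  by have := gbdZ hab ler01 a^-1 gQ; rewrite (uabsV hab) a1 invr1 mul1r.
Qed.

(** G is minus the inverse of the product modulo D. Starting from -1, the linear forms are divided
    out one at a time, each at the cost of a factor delta^-1. *)
Lemma inv_prod_lin_mod (I : eqType) (r : seq I) (al : I -> F) (delta : R) D :
  (forall i, i \in r -> ab (al i) = 1) -> (forall i, i \in r -> ab (al i - 1) <= 1) ->
  0 < delta <= 1 -> (forall i, i \in r -> delta <= ab D.[(al i)^-1 - 1]) ->
  D != 0 -> gb1 1 D ->
  exists G : {poly F}, [/\ (size G <= (size D).-1)%N,
                D %| (\prod_(i <- r) lin (al i)) * G + 1 & gb1 (delta^-1 ^+ size r) G].
Proof.
move=> h1 h2 hd h3 D0 gD.
(* For a constant D the size bound leaves only G = 0 and excludes the starting value -1. *)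
have [s1|s1] := leqP (size D) 1.
  exists 0; split; first by rewrite size_poly0.
    by rewrite mulr0 add0r dvdp1 eqn_leq s1 size_poly_gt0.
  rewrite rmorph0; apply: (gbd0 hab); apply: exprn_ge0; rewrite invr_ge0.
  by case/andP: hd => /ltW.
elim: r h1 h2 h3 => [|i r IH] h1 h2 h3.
  exists (-1); split; first by rewrite size_polyN size_poly1 -ltnS prednK // ltnW.
    by rewrite big_nil mul1r addNr dvdp0.
  by rewrite rmorphN rmorph1 expr0; apply: (gbdN hab); apply: gbd1.
have sub j : j \in r -> j \in i :: r by rewrite inE orbC => ->.
case: IH => [j /sub|j /sub|j /sub|G [sG dG gG]]; [exact: h1|exact: h2|exact: h3|].
have ii : i \in i :: r by rewrite mem_head.
have [G1 [sG1 dG1 gG1]] := inv_lin_mod (h1 _ ii) (h2 _ ii) hd (h3 _ ii) gD gG sG.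
exists G1; split => //; last by rewrite /= exprSr.
rewrite big_cons [lin _ * _]mulrC -mulrA.
set A := \prod_(_ <- _) _ in dG *; set l := lin _ in dG1 *.
have -> : A * (l * G1) + 1 = A * (l * G1 - G) + (A * G + 1) by ring.
by rewrite dvdp_addr // dvdp_mull.
Qed.

End GaussDivision.

(** * Principal units and the polynomials omega_n *)

Section PrincipalUnits.
Variables (R : realType) (p : nat) (S : QpSetting R p).
Hypotheses (hp : prime p) (hodd : odd p).
Local Notation K := (Qp S).
Local Notation ab := (@absQ _ _ S).
Local Notation hab := (@ultra_absQ _ _ S).
Local Notation pV := (p%:R^-1 : R).

Lemma pV_gt0 : 0 < pV.
Proof. by rewrite invr_gt0 ltr0n prime_gt0. Qed.

Lemma pV_lt1 : pV < 1.
Proof. by rewrite invf_lt1 ?ltr0n ?prime_gt0 // ltr1n prime_gt1. Qed.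

Lemma absQ_dvd n : (p %| n)%N -> ab n%:R <= pV.
Proof.
case/dvdnP => m ->; rewrite natrM (uabsM hab) absQ_p.
by apply: ler_piMl; [exact: ltW pV_gt0|exact: uabs_nat hab _].
Qed.

(** In a Bezout relation a n = 1 + b p the right side has absolute value 1, while both factors on
    the left have at most 1. *)
Lemma absQ_coprime n : coprime n p -> ab n%:R = 1.
Proof.
move=> cnp; have n0 : (0 < n)%N.
  by case: n cnp => //; rewrite /coprime gcd0n => /eqP e; have := prime_gt1 hp; rewrite e.
have [[a b] /= e] := coprimeP _ n0 cnp.
have {}e : (a * n = 1 + b * p)%N.
  by rewrite -e subnK // ltnW // -subn_gt0 e.
have h : ab a%:R * ab n%:R = 1.
  rewrite -(uabsM hab) -natrM e natrD (uabs_dominant hab (y := 1)) ?(uabs1 hab) //.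
  rewrite addrAC subrr add0r; apply: le_lt_trans pV_lt1.
  by apply: absQ_dvd; rewrite dvdn_mull.
apply/eqP; rewrite eq_le (uabs_nat hab) /= -h.
by rewrite ler_piMl ?(uabs_ge0 hab) ?(uabs_nat hab).
Qed.

Lemma absQ_expB1_linear (r : R) (w : K) k : ab w <= 1 -> ab (w - 1) <= r -> r <= 1 ->
  ab (w ^+ k - 1 - (w - 1) *+ k) <= r ^+ 2.
Proof.
move=> w1 hw r1; have r0 : 0 <= r := le_trans (uabs_ge0 hab _) hw.
elim: k => [|k IH]; first by rewrite expr0 subrr mulr0n subr0 (uabs0 hab) exprn_ge0.
have -> : w ^+ k.+1 - 1 - (w - 1) *+ k.+1 =
    (w ^+ k - 1 - (w - 1) *+ k) + (w - 1) * (w ^+ k - 1).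
  by rewrite exprS mulrS; ring.
apply: (uabsD_le hab) => //; rewrite (uabsM hab) expr2.
by apply: ler_pM; rewrite ?(uabs_ge0 hab) // (uabs_exp_sub1_le hab).
Qed.

(* Here p must be odd: the linear term is (w - 1) times p(p-1)/2, divisible by p. *)
Lemma absQ_geo (w : K) : ab (w - 1) <= pV -> ab (\sum_(k < p) w ^+ k) = pV.
Proof.
move=> hw; have w1 : ab w <= 1.
  rewrite -(subrK 1 w); apply: (uabsD_le hab); rewrite ?(uabs1 hab) //.
  exact: le_trans hw (ltW pV_lt1).
rewrite -(absQ_p S); apply: (uabs_dominant hab); rewrite absQ_p.
have p2 : pV ^+ 2 < pV by rewrite expr2 gtr_pMl ?pV_gt0 ?pV_lt1.
apply: le_lt_trans p2.
have -> : \sum_(k < p) w ^+ k - p%:R =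
    \sum_(k < p) (w ^+ k - 1 - (w - 1) *+ k) + (w - 1) * 'C(p, 2)%:R.
  rewrite -bin2_sum big_mkord natr_sum mulr_sumr -big_split /= -[p in p%:R]card_ord.
  rewrite -sumr_const -sumrB; apply: eq_bigr => k _.
  by rewrite mulr_natr subrK.
apply: (uabsD_le hab).
  apply: (uabs_sum_le hab) => [|k _]; first exact: exprn_ge0 (ltW pV_gt0).
  by apply: absQ_expB1_linear => //; exact: ltW pV_lt1.
rewrite (uabsM hab) expr2; apply: ler_pM; rewrite ?(uabs_ge0 hab) //.
apply: absQ_dvd; apply: prime_dvd_bin => //=.
by case: (p) hp hodd => [|[|[|]]].
Qed.

Lemma principal_unit_abs (w : K) : ab (w - 1) <= pV -> ab w = 1.
Proof.
move=> h; rewrite (uabs_dominant hab (y := 1)) ?(uabs1 hab) //.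
exact: le_lt_trans h pV_lt1.
Qed.

Lemma principal_unitX (w : K) n : ab (w - 1) <= pV -> ab (w ^+ n - 1) <= pV.
Proof. by move=> h; apply: (uabs_exp_sub1_le hab) => //; rewrite principal_unit_abs. Qed.

Lemma principal_unitM (w w' : K) : ab (w - 1) <= pV -> ab (w' - 1) <= pV ->
  ab (w * w' - 1) <= pV.
Proof.
move=> h h'; have -> : w * w' - 1 = w * (w' - 1) + (w - 1) by ring.
by apply: (uabsD_le hab) => //; rewrite (uabsM hab) principal_unit_abs // mul1r.
Qed.

Lemma principal_unitV (w : K) : ab (w - 1) <= pV -> ab (w^-1 - 1) <= pV.
Proof.
move=> h; have w0 : w != 0 by rewrite -(uabs_eq0 hab) principal_unit_abs ?oner_eq0.
have -> : w^-1 - 1 = - (w^-1 * (w - 1)) by rewrite mulrBr mulVf // mulr1 opprB.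
by rewrite (uabsN hab) (uabsM hab) (uabsV hab) principal_unit_abs // invr1 mul1r.
Qed.

Lemma principal_unitXz (w : K) (m : int) : ab (w - 1) <= pV -> ab (w ^ m - 1) <= pV.
Proof.
case: m => n h; rewrite ?NegzE -?exprnN -?exprnP; first exact: principal_unitX.
by apply: principal_unitV; apply: principal_unitX.
Qed.

(** Induction on m reduces to w^q = 1 with q prime. Then w - 1 is killed by the sum of the w^k for k
    < q, whose absolute value is that of q: 1/p if q = p, and 1 otherwise since every w^k is close
    to 1. *)
Lemma principal_unit_torsion_free (w : K) m : ab (w - 1) <= pV -> (0 < m)%N ->
  w ^+ m = 1 -> w = 1.
Proof.
elim/ltn_ind: m w => m IH w hw m0 wm.
have [m1|m1] := leqP m 1.
  have e : m = 1%N by apply/eqP; rewrite eqn_leq m1.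
  by rewrite e in wm.
have pq := pdiv_prime m1; set q := pdiv m in pq.
have dq : (q %| m)%N := pdiv_dvd m.
have wq : w ^+ q = 1.
  apply: (IH (m %/ q)%N); rewrite ?ltn_Pdiv ?prime_gt1 //.
  - exact: principal_unitX.
  - by rewrite divn_gt0 ?prime_gt0 // dvdn_leq.
  - by rewrite -exprM mulnC divnK.
apply/eqP; rewrite -subr_eq0.
have /eqP : (w - 1) * \sum_(k < q) w ^+ k = 0 by rewrite -subrX1 wq subrr.
rewrite mulf_eq0 => /orP[//|]; rewrite -(uabs_eq0 hab).
have [->|npq] := eqVneq q p; first by rewrite absQ_geo // gt_eqF ?pV_gt0.
suff -> : ab (\sum_(k < q) w ^+ k) = 1 by rewrite oner_eq0.
have cq : ab q%:R = 1.
  by apply: absQ_coprime; rewrite prime_coprime // dvdn_prime2.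
rewrite -cq; apply: (uabs_dominant hab); rewrite cq.
apply: le_lt_trans pV_lt1; rewrite -[q in q%:R]card_ord -sumr_const -sumrB.
apply: (uabs_sum_le hab) => [|k _]; first exact: ltW pV_gt0.
exact: principal_unitX.
Qed.

Variable u : K.
Hypothesis hu : topgen u.

Lemma topgen_principal : ab (u - 1) <= pV.
Proof. by case: hu. Qed.

Lemma topgen_neq1 : u <> 1.
Proof.
case: hu => _ dense u1.
have h1 : ab (1 + p%:R - 1) = pV by rewrite addrAC subrr add0r absQ_p.
have [|k] := dense (1 + p%:R) _ pV pV_gt0; first by rewrite h1.
by rewrite u1 exp1rz -(uabsN hab) opprB h1 ltxx.
Qed.

Lemma topgen_expz_inj (i j : int) : u ^ i = u ^ j -> i = j.
Proof.
have u0 : u != 0.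
  by rewrite -(uabs_eq0 hab) (principal_unit_abs topgen_principal) oner_eq0.
have nat_inj n : u ^+ n = 1 -> n = 0%N.
  case: n => // n h; case: topgen_neq1.
  exact: (principal_unit_torsion_free topgen_principal _ h).
move=> e; have {e} : u ^ (i - j) = 1 by rewrite expfzDr // e -expfzDr // subrr expr0z.
move=> h; apply/eqP; rewrite -subr_eq0.
case: (i - j) h => n; first by rewrite -exprnP => /nat_inj ->.
rewrite NegzE -exprnN => /eqP; rewrite invr_eq1 => /eqP /nat_inj //.
Qed.

(** This is v^(-j) with v = u^(p^n). *)
Definition al (n : nat) (j : int) : K := (u ^ (- j)) ^+ (p ^ n).

(** Each p-th power multiplies the distance to 1 by exactly 1/p. So the constant term [al n j - 1]
    of the twist, written as a polynomial in omega_n, is as small as omega_n. *)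
Lemma al_sub1_le n j : ab (al n j - 1) <= pV ^+ n.+1.
Proof.
elim: n => [|n IH].
  by rewrite /al expn0 expr1; apply: principal_unitXz topgen_principal.
rewrite /al expnSr exprM subrX1 (uabsM hab) -/(al n j) exprSr.
have hw : ab (al n j - 1) <= pV by apply: principal_unitX; apply: principal_unitXz topgen_principal.
by rewrite absQ_geo // ler_pM2r ?pV_gt0.
Qed.

Lemma al_principal n j : ab (al n j - 1) <= pV.
Proof. by apply: principal_unitX; apply: principal_unitXz topgen_principal. Qed.

Lemma al_abs n j : ab (al n j) = 1.
Proof. exact: principal_unit_abs (al_principal n j). Qed.

Lemma al_neq0 n j : al n j != 0.
Proof. by rewrite -(uabs_eq0 hab) al_abs oner_eq0. Qed.

Lemma al_inj n : injective (al n).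
Proof.
move=> i j e; apply: oppr_inj; apply: topgen_expz_inj.
have hu' k : ab (u ^ k - 1) <= pV := principal_unitXz k topgen_principal.
have n0 k : u ^ k != 0 by rewrite -(uabs_eq0 hab) principal_unit_abs ?oner_eq0.
apply/eqP; rewrite -(inj_eq (mulIf (invr_neq0 (n0 (- j))))) mulfV //; apply/eqP.
apply: (@principal_unit_torsion_free _ (p ^ n)).
- exact: principal_unitM (hu' _) (principal_unitV (hu' _)).
- by rewrite expn_gt0 prime_gt0.
- by rewrite exprMn exprVn -/(al n i) e mulfV ?al_neq0.
Qed.

End PrincipalUnits.

Lemma prod_dvdp_pairwise (F : fieldType) (I : eqType) (r : seq I) (E : I -> {poly F}) P :
  uniq r -> (forall i j, i \in r -> j \in r -> i != j -> coprimep (E i) (E j)) ->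
  (forall i, i \in r -> E i %| P) -> \prod_(i <- r) E i %| P.
Proof.
elim: r => [|x r IH] /=; first by rewrite big_nil dvd1p.
move=> /andP[xr ur] hc hd; rewrite big_cons Gauss_dvdp.
  rewrite hd ?mem_head //= IH // => [i j ir jr|i ir]; last by rewrite hd // inE ir orbT.
  by apply: hc; rewrite inE ?ir ?jr orbT.
rewrite big_seq_cond; apply: (big_ind (fun Q => coprimep (E x) Q)) => [|Q Q' h h'|i].
- exact: coprimep1.
- by rewrite coprimepMr h.
- rewrite andbT => ir; apply: hc; rewrite ?mem_head ?inE ?ir ?orbT //.
  by apply: contraNneq xr => ->.
Qed.

Lemma size_prod_pred (F : fieldType) (I : Type) (r : seq I) (E : I -> {poly F}) :
  (forall i, E i != 0) ->
  size (\prod_(i <- r) E i) = (\sum_(i <- r) (size (E i)).-1).+1.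
Proof.
move=> E0; elim: r => [|x r IH]; first by rewrite !big_nil size_poly1.
rewrite !big_cons size_mul //; last first.
  by elim/big_ind: _ => // [|P Q]; [exact: oner_neq0|exact: mulf_neq0].
by rewrite IH addnS /= -[in LHS](prednK (n := size (E x))) ?size_poly_gt0.
Qed.

(** * Cyclotomic factors and Gauss norms of omega_n *)

Section Cyclotomic.
Variables (R : realType) (p : nat) (S : QpSetting R p).
Hypothesis hp : prime p.
Local Notation K := (Qp S).
Local Notation ab := (@absQ _ _ S).
Local Notation hab := (@ultra_absQ _ _ S).
Local Notation pV := (p%:R^-1 : R).
Local Notation om := (@omega R p S).
Local Notation gb rho C P := (gbd ab rho C (fps_of_poly P)).

(** The p-th cyclotomic polynomial evaluated at P. *)
Definition geo (P : {poly K}) : {poly K} := \sum_(k < p) P ^+ k.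

Lemma omega_size n : size (om n) = (p ^ n).+1.
Proof.
have e : ('X + 1 : {poly K}) = 'X - (-1)%:P by rewrite polyCN opprK polyC1.
have h : size (('X + 1 : {poly K}) ^+ (p ^ n)) = (p ^ n).+1 by rewrite e size_exp_XsubC.
by rewrite /omega size_polyDl ?h // size_polyN size_poly1 ltnS expn_gt0 prime_gt0.
Qed.

Lemma omega_neq0 n : om n != 0.
Proof. by rewrite -size_poly_gt0 omega_size. Qed.

Lemma omega0 : om 0 = 'X.
Proof. by rewrite /omega expn0 expr1 addrK. Qed.

Lemma omega_succ n : om n.+1 = (om n + 1) ^+ p - 1.
Proof. by rewrite /omega subrK -exprM -expnSr. Qed.

Lemma xiS n : xi S n.+1 = geo (om n + 1).
Proof. by rewrite /xi omega_succ subrX1 addrK mulrC mulpK ?omega_neq0. Qed.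

(** Two bounds on the same polynomial: r carries the decay to be propagated, while s may be cruder
    and only serves to estimate the factor Phi_p(1 + omega_n). *)
Lemma omega_bound_step (rho r s : R) n : 0 <= rho -> s <= 1 ->
  gb rho r (om n) -> gb rho s (om n) -> gb rho (r * Num.max pV s) (om n.+1).
Proof.
move=> r0 s1 h h'; rewrite omega_succ subrX1 addrK rmorphM; apply: (gbdM hab) => //.
rewrite rmorph_sum /=; under eq_bigr do rewrite rmorphXn rmorphD rmorph1 addrC.
by rewrite -(absQ_p S); apply: (gbd_sum_exp1D hab).
Qed.

Lemma omega_bound1 (rho : R) n : 0 <= rho <= 1 -> gb rho rho (om n).
Proof.
move=> /andP[r0 r1]; elim: n => [|n IH]; first by rewrite omega0; apply: (gbd_polyX hab).
apply: gbd_le (omega_bound_step r0 r1 IH IH).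
by rewrite ler_piMr // ge_max r1 ltW ?pV_lt1.
Qed.

(* The bound r_n on the Gauss norm of omega_n satisfies r_(n+1) <= r_n max(1/p, r_n): it
   decreases geometrically until r_n <= 1/p, and from then on gains a factor 1/p each time. *)
Lemma omega_bound (rho : R) : 0 < rho < 1 ->
  exists C, forall n, gb rho (C * pV ^+ n) (om n).
Proof.
move=> /andP[r0 r1]; pose q := Num.max pV rho.
have q0 : 0 <= q by rewrite le_max ltW ?pV_gt0.
have q1 : q < 1 by rewrite gt_max pV_lt1.
have hq n : gb rho (q ^+ n) (om n).
  elim: n => [|n IH].
    by rewrite expr0; apply: gbd_le (omega_bound1 0 _); rewrite ?(ltW r0) ltW.
  rewrite exprSr; apply: (omega_bound_step (ltW r0) (ltW r1) IH).
  by apply: omega_bound1; rewrite !ltW.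
have [M hM] := geometric_small 1 (introT andP (conj q0 q1)) (pV_gt0 R hp).
have gM k : gb rho (pV ^+ k.+1) (om (M + k)).
  elim: k => [|k IH].
    by rewrite addn0 expr1; apply: gbd_le (hq M); rewrite -[_ ^+ M]mul1r hM.
  have hk : pV ^+ k.+1 <= pV.
    by rewrite -[X in _ <= X]expr1 ler_wiXn2l // ltW ?pV_gt0 ?pV_lt1.
  rewrite addnS exprSr; apply: gbd_le (omega_bound_step (ltW r0) _ IH IH).
    by rewrite ler_wpM2l ?exprn_ge0 ?(ltW (pV_gt0 _ _)) // ge_max lexx.
  exact: le_trans hk (ltW (pV_lt1 _ hp)).
exists (p%:R ^+ M) => n.
have p0 : (p%:R : R) != 0 by rewrite pnatr_eq0 -lt0n prime_gt0.
have [nM|Mn] := ltnP n M.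
  apply: gbd_le (omega_bound1 n _); last by rewrite !ltW.
  apply: le_trans (ltW r1) _.
  rewrite -(subnK (ltnW nM)) exprD -mulrA -exprMn mulfV // expr1n mulr1.
  by rewrite exprn_ege1 // ler1n prime_gt0.
rewrite -(subnKC Mn); apply: gbd_le (gM _).
rewrite exprD mulrA -exprMn mulfV // expr1n mul1r exprS.
by rewrite ler_piMl ?exprn_ge0 // ltW ?pV_gt0 ?pV_lt1.
Qed.

Variable u : K.
Local Notation alu := (al u).

Lemma twist_omega n j : twist u j (om n) = lin (alu n j) \Po om n.
Proof.
rewrite /twist /lin {1}/omega !(rmorphB, rmorphD, rmorphM, rmorph1, rmorphXn) /=.
rewrite !comp_polyX !comp_polyC subrK exprMn /omega subrK; exact: erefl.
Qed.

Definition cyc n j : {poly K} := geo ((alu n j)%:P * ('X + 1)).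

Lemma lin_comp a P : lin a \Po P = a%:P * (P + 1) - 1 :> {poly K}.
Proof. by rewrite /lin !(rmorphB, rmorphD, rmorphM, rmorph1) /= comp_polyC comp_polyX. Qed.

Lemma geo_comp P Q : geo P \Po Q = geo (P \Po Q).
Proof. by rewrite /geo rmorph_sum; apply: eq_bigr => k _; rewrite rmorphXn. Qed.

Lemma cyc_comp n j P : cyc n j \Po P = geo ((alu n j)%:P * (P + 1)).
Proof.
rewrite geo_comp; congr geo; move: (alu n j) => a.
by rewrite !(rmorphD, rmorphM, rmorph1) /= comp_polyC comp_polyX.
Qed.

Lemma twist_xi n j : twist u j (xi S n.+1) = cyc n j \Po om n.
Proof.
have := twist_omega n j; rewrite xiS /twist cyc_comp lin_comp geo_comp => h.
by congr geo; rewrite rmorphD rmorph1 /= h subrK.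
Qed.

(** In the variable omega_n, the modulus attached to j in J' splits into a linear and a cyclotomic
    factor, so its congruence can be checked factor by factor. *)
Lemma twist_omegaS n j : twist u j (om n.+1) = (lin (alu n j) * cyc n j) \Po om n.
Proof.
rewrite comp_polyM cyc_comp lin_comp -subrX1 twist_omega lin_comp omega_succ subrK exprMn.
by rewrite -polyC_exp /al expnSr exprM.
Qed.

End Cyclotomic.

(** * Interpolation polynomials *)

Section Interpolation.
Variables (R : realType) (p : nat) (S : QpSetting R p).
Hypotheses (hp : prime p) (hodd : odd p).
Local Notation K := (Qp S).
Local Notation ab := (@absQ _ _ S).
Local Notation hab := (@ultra_absQ _ _ S).
Local Notation pV := (p%:R^-1 : R).
Local Notation om := (@omega R p S).
Local Notation gb rho C P := (gbd ab rho C (fps_of_poly P)).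
Variable u : K.
Hypothesis hu : topgen u.
Local Notation alu := (al u).
Local Notation cyc := (cyc u).

Lemma size_lin (a : K) : a != 0 -> size (lin a) = 2.
Proof. by move=> a0; rewrite linE // size_scale // size_XsubC. Qed.

Lemma size_twist j (P : {poly K}) : size (twist u j P) = size P.
Proof.
apply: size_comp_poly2; rewrite -/(lin _) size_lin //.
have := al_neq0 hp hu 0 j; by rewrite /al expn0 expr1.
Qed.

Lemma lin_mul_cyc n j : lin (alu n j) * cyc n j = om 1 \Po lin (alu n j).
Proof.
rewrite (omega_succ S 0) omega0 !(rmorphB, rmorphD, rmorph1, rmorphXn) /= comp_polyX.
rewrite subrX1 addrK; congr (_ * _); apply: eq_bigr => k _.
by rewrite /lin subrK.
Qed.

Lemma size_cyc n j : size (cyc n j) = p.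
Proof.
have a0 := al_neq0 hp hu n j.
have sl := size_lin a0.
have s1 : size (lin (alu n j) * cyc n j) = p.+1.
  by rewrite lin_mul_cyc size_comp_poly2 // omega_size // expn1.
have l0 : lin (alu n j) != 0 by rewrite -size_poly_gt0 sl.
have c0 : cyc n j != 0.
  by apply/eqP => h; move: s1; rewrite h mulr0 size_poly0.
by move: s1; rewrite size_mul // sl /= => -[].
Qed.

Lemma cyc_neq0 n j : cyc n j != 0.
Proof. by rewrite -size_poly_gt0 size_cyc prime_gt0. Qed.

(** Modulo [lin] the cyclotomic factor becomes Phi_p(1) = p, a nonzero constant. *)
Lemma lin_coprime_cyc n j : coprimep (lin (alu n j)) (cyc n j).
Proof.
have -> : cyc n j = \sum_(k < p) (1 + lin (alu n j)) ^+ k.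
  by apply: eq_bigr => k _; rewrite /lin [1 + _]addrC subrK.
rewrite sum_exp1D addrC mulrC coprimep_addl_mul -polyC_natr.
rewrite -[_%:P]mulr1 mul_polyC coprimepZr ?coprimep1 //.
by rewrite -(uabs_eq0 hab) absQ_p gt_eqF ?pV_gt0.
Qed.

(** With P = 1 + omega_n, b (a P - 1) - a (b P - 1) = a - b, which is nonzero because [al n] is
    injective. *)
Lemma twist_coprime n i j : i != j -> coprimep (twist u i (om n)) (twist u j (om n)).
Proof.
move=> ij; rewrite !twist_omega !lin_comp.
set a := alu n i; set b := alu n j; set P := om n + 1.
have ab0 : a - b != 0 by rewrite subr_eq0 (inj_eq (al_inj hp hodd hu (n := n))).
apply/Bezout_eq1_coprimepP; exists ((b / (a - b))%:P, (- (a / (a - b)))%:P) => /=.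
have -> : (b / (a - b))%:P * (a%:P * P - 1) + (- (a / (a - b)))%:P * (b%:P * P - 1)
  = (a - b)%:P * ((a - b)^-1)%:P.
  by rewrite !(polyCM, polyCN, polyCB); ring.
by rewrite -polyCM mulfV.
Qed.

Lemma gb_cyc n j : gb 1 1 (cyc n j).
Proof.
rewrite rmorph_sum; apply: (gbd_sum hab) => // k _.
rewrite rmorphXn /= -[1](expr1n _ k); apply: (gbdX hab) => //.
rewrite expr1n rmorphM -[1](mulr1 1); apply: (gbdM hab) => //.
  by rewrite -(al_abs hp hu n j); apply: gbd_polyC hab _ _.
rewrite mulr1 rmorphD rmorph1; apply: (gbdD hab) => //; last exact: (gbd1 hab).
exact: (gbd_polyX hab).
Qed.

(** At the root of the linear form, 1 + Y is the inverse of [al n i], so Phi_p is evaluated at a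
    principal unit. This exact value is the source of [delta] for the inversion modulo the
    cyclotomic factors. *)
Lemma absQ_cyc_horner n i j : ab (cyc n j).[(alu n i)^-1 - 1] = pV.
Proof.
rewrite -(@absQ_geo _ _ S hp hodd (alu n j * (alu n i)^-1)); last first.
  apply: (principal_unitM hp); first exact: al_principal.
  by apply: principal_unitV => //; exact: al_principal.
congr ab; rewrite horner_sum; apply: eq_bigr => k _.
by rewrite !hornerE subrK.
Qed.

Definition linprod n (J : seq int) : {poly K} := \prod_(j <- J) lin (alu n j).

Lemma omegaS_comp n J : omegaS u n J = linprod n J \Po om n.
Proof.
by rewrite /omegaS rmorph_prod; apply: eq_bigr => j _; rewrite twist_omega.
Qed.

(* The bound does not depend on n: as n grows the problem tends to the inversion of
   Y^#|J| modulo a power of the p-th cyclotomic polynomial at 1 + Y. *)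
Lemma inverse_mod_cyc n (J' J : seq int) : exists G : {poly K},
  [/\ (size G <= (p - 1) * size J')%N,
      forall j, j \in J' -> cyc n j %| linprod n J * G + 1 &
      gb 1 ((pV ^+ size J')^-1 ^+ size J) G].
Proof.
pose D := \prod_(j <- J') cyc n j.
have sD : (size D).-1 = ((p - 1) * size J')%N.
  rewrite size_prod_pred /=; last exact: cyc_neq0.
  under eq_bigr do rewrite size_cyc.
  by rewrite big_const_seq count_predT iter_addn_0 subn1.
have D0 : D != 0 by rewrite -size_poly_gt0 size_prod_pred //; exact: cyc_neq0.
have [i|i||i|||G [sG dG gG]] :=
  @inv_prod_lin_mod _ _ _ hab _ J (alu n) (pV ^+ size J') D.
- by move=> _; rewrite (al_abs hp hu).
- by move=> _; apply: le_trans (al_principal hp hu n i) (ltW (pV_lt1 _ hp)).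
- by rewrite exprn_gt0 ?pV_gt0 // exprn_ile1 // ltW ?pV_gt0 ?pV_lt1.
- move=> _; rewrite horner_prod (uabs_prod hab).
  under eq_bigr do rewrite absQ_cyc_horner.
  by rewrite big_const_seq count_predT iter_mulr_1.
- exact: D0.
- rewrite rmorph_prod -[X in gbd _ _ X](expr1n _ (size J')).
  by apply: (gbd_prod hab) => // j; exact: gb_cyc.
exists G; split => //; first by rewrite -sD.
move=> j jJ; apply: dvdp_trans dG.
by rewrite /D (big_rem j) //= dvdp_mulr.
Qed.

(** For m = p^n the left side is the total degree of the moduli, and the right side the bound in
    [xit_spec] at level n+1. *)
Lemma sum_mem_size (J' J : seq int) m : uniq J -> uniq J' -> {subset J' <= J} ->
  (\sum_(j <- J) (if j \in J' then p * m else m) = ((p - 1) * size J' + size J) * m)%N.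
Proof.
move=> uJ uJ' sJ.
have -> : size J' = count (mem J') J.
  rewrite -size_filter; apply/perm_size/uniq_perm => //; first exact: filter_uniq.
  by move=> j; rewrite mem_filter; apply/idP/andP => [h|[]] //; split; last exact: sJ.
elim: J {uJ uJ' sJ} => [|j J IH]; first by rewrite big_nil muln0.
rewrite big_cons IH /=; have p0 := prime_gt0 hp; case: (j \in J') => /=.
  rewrite -{1}(subnK p0) !mulnDl !mulnDr !mulnS mulnDl mul1n; ring.
by rewrite add0n -mulSn addnS.
Qed.

(** The difference of two solutions is divisible by a product of coprime moduli whose degree equals
    the bound imposed on its size. *)
Lemma xit_spec_unique n (J' J : seq int) P Q : uniq J -> uniq J' -> {subset J' <= J} ->
  xit_spec u n.+1 J' J P -> xit_spec u n.+1 J' J Q -> P = Q.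
Proof.
move=> uJ uJ' sJ [sP [dP eP]] [sQ [dQ eQ]].
pose E j := twist u j (om (if j \in J' then n.+1 else n)).
have E0 j : E j != 0 by rewrite -size_poly_gt0 size_twist omega_size.
(* Moduli of the two levels are compared through omega_(n+1): its twists are coprime, and
   coprimality passes to divisors. *)
have dE j : E j %| twist u j (om n.+1).
  by rewrite /E; case: ifP => // _; rewrite twist_omegaS comp_polyM -twist_omega dvdp_mulr.
have dPQ : \prod_(j <- J) E j %| P - Q.
  apply: prod_dvdp_pairwise => // [i j _ _ ij|j jJ].
    exact: coprimep_dvdl (dE j) (coprimep_dvdr (dE i) (twist_coprime n.+1 ij)).
  rewrite /E; case: ifPn => jJ'.
    have -> : P - Q = (P - p%:R^-1 *: twist u j (xi S n.+1)) -
                      (Q - p%:R^-1 *: twist u j (xi S n.+1)) by rewrite opprB subrKA.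
    by rewrite dvdp_sub ?dP ?dQ.
  have -> : P - Q = (P - 1) - (Q - 1) by rewrite opprB subrKA.
  by rewrite dvdp_sub ?eP ?eQ.
apply/eqP; rewrite -subr_eq0; apply/negPn/negP => PQ0.
have := dvdp_leq PQ0 dPQ; rewrite size_prod_pred //.
have -> : (\sum_(j <- J) (size (E j)).-1 = ((p - 1) * size J' + size J) * p ^ n)%N.
  rewrite -sum_mem_size //; apply: eq_bigr => j _.
  by rewrite /E size_twist omega_size //=; case: ifP; rewrite // expnS.
apply/negP; rewrite -leqNgt; apply: leq_trans (size_polyD _ _) _.
by rewrite size_polyN geq_max sP.
Qed.

(** An explicit polynomial F in omega_n solves the interpolation problem; hence the [epsilon]
    defining [xit] returns a solution, and uniqueness identifies it with F(omega_n). *)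
Lemma xitS n (J' J : seq int) : uniq J -> uniq J' -> {subset J' <= J} ->
  (0 < size J)%N -> exists G : {poly K},
    xit u n.+1 J' J = 1 + omegaS u n J * (G \Po om n) /\
    gb 1 ((pV ^+ size J')^-1 ^+ size J) G.
Proof.
move=> uJ uJ' sJ J0; have [G [sG dG gG]] := inverse_mod_cyc n J' J.
exists G; split => //.
pose F := 1 + linprod n J * G.
have eF : 1 + omegaS u n J * (G \Po om n) = F \Po om n.
  by rewrite /F rmorphD rmorphM rmorph1 /= omegaS_comp.
have dl j : j \in J -> lin (alu n j) %| linprod n J * G.
  by move=> jJ; rewrite /linprod (big_rem j) //= -mulrA dvdp_mulr.
have p0 : (p%:R : K) != 0 by rewrite -(uabs_eq0 hab) absQ_p gt_eqF ?pV_gt0.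
have spec : xit_spec u n.+1 J' J (F \Po om n).
  split; [|split] => /=.
  - have sF : (size F <= (p - 1) * size J' + size J)%N.
      apply: leq_trans (size_polyD _ _) _; rewrite geq_max size_poly1.
      rewrite (leq_trans J0) ?leq_addl //=.
      apply: leq_trans (size_polyMleq _ _) _.
      rewrite /linprod size_prod_pred; last first.
        by move=> j; rewrite -size_poly_gt0 size_lin ?al_neq0.
      under eq_bigr do rewrite size_lin ?al_neq0 //.
      by rewrite big_const_seq count_predT iter_addn_0 mul1n addSn /= addnC leq_add2r.
    have [->|F0] := eqVneq F 0; first by rewrite comp_poly0 size_poly0.
    apply: leq_trans (leqSpred _) _; rewrite size_comp_poly omega_size //=.
    apply: (@leq_trans ((size F).-1 * p ^ n + p ^ n)).
      by rewrite -addn1 leq_add2l expn_gt0 prime_gt0.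
    by rewrite addnC -mulSn prednK ?size_poly_gt0 // leq_mul2r sF orbT.
  (* Modulo [cyc] both F and [cyc] / p vanish, the former by the choice of G. Modulo [lin], F is 1
     and [cyc] is congruent to p, so [cyc] / p is 1 as well. *)
  - move=> j jJ'; rewrite twist_omegaS (twist_xi hp).
    rewrite -linearZ -rmorphB /= dvdp_comp_poly // Gauss_dvdp ?lin_coprime_cyc //.
    apply/andP; split; last first.
      by apply: dvdp_sub; [rewrite /F addrC dG|rewrite -mul_polyC dvdp_mull].
    rewrite /F addrAC dvdp_addl ?dl ?sJ //.
    have -> : cyc n j = p%:R%:P + lin (alu n j) *
        \sum_(k < p) \sum_(i < k) (1 + lin (alu n j)) ^+ i.
      rewrite polyC_natr -sum_exp1D; apply: eq_bigr => k _.
      by rewrite /lin [1 + _]addrC subrK.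
    rewrite scalerDr -mul_polyC -polyCM mulVf // opprD addrA subrr add0r.
    by rewrite scalerAr dvdpNr dvdp_mulr.
  - move=> j jJ jJ'; rewrite twist_omega -eF addrAC subrr add0r omegaS_comp -comp_polyM.
    by rewrite dvdp_comp_poly ?dl.
rewrite eF; apply: (xit_spec_unique uJ uJ' sJ _ spec).
by apply: (ClassicalEpsilon.epsilon_spec (inhabits 0)); exists (F \Po om n).
Qed.

End Interpolation.

(** * Growth of the powers of Frobenius *)

Section MatrixPowers.
Variables (R : realType) (F : fieldType) (ab : F -> R).
Hypothesis hab : ultra_abs ab.

Definition mx_le m n (C : R) (A : 'M[F]_(m, n)) : Prop := forall i j, ab (A i j) <= C.

(** The ultrametric inequality replaces a sum by a maximum, so the rate r is kept without a factor k
    even when |c| = r; this is why Jordan blocks do no harm. The term C / r absorbs [y k], which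
    enters at index k+1. *)
Lemma linear_rec_bound m n (x y : nat -> 'M[F]_(m, n)) c (r C : R) : 0 < r -> ab c <= r ->
  0 <= C -> (forall k, x k.+1 = c *: x k + y k) -> (forall k, mx_le (C * r ^+ k) (y k)) ->
  exists2 D : R, 0 <= D & forall k, mx_le (D * r ^+ k) (x k).
Proof.
move=> r0 hc C0 hx hy.
pose X0 := \sum_i \sum_j ab (x 0%N i j).
have X00 : 0 <= X0 by do 2![apply: sumr_ge0 => ? _]; exact: uabs_ge0 hab _.
have hX0 i j : ab (x 0%N i j) <= X0.
  rewrite /X0 (bigD1 i) //= (bigD1 j) //= -addrA lerDl addr_ge0 //.
    by apply: sumr_ge0 => ? _; exact: uabs_ge0 hab _.
  by do 2![apply: sumr_ge0 => ? _]; exact: uabs_ge0 hab _.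
have Cr0 : 0 <= C / r by rewrite divr_ge0 // ltW.
exists (X0 + C / r); first exact: addr_ge0.
elim=> [|k IH] i j; first by rewrite expr0 mulr1; apply: le_trans (hX0 i j) _; rewrite lerDl.
rewrite hx !mxE; apply: (uabsD_le hab).
  rewrite (uabsM hab) exprSr mulrA mulrC.
  by apply: ler_pM (IH i j) hc; exact: uabs_ge0 hab _.
apply: le_trans (hy k i j) _; rewrite exprS mulrA ler_wpM2r ?exprn_ge0 ?(ltW r0) //.
by rewrite mulrDl divfK ?gt_eqF // lerDr mulr_ge0 // ltW.
Qed.

Variable d : nat.
Implicit Types (A B M : 'M[F]_d).

(* M (A - l) is annihilated by the remaining factors, and
   M A^(k+1) = l M A^k + (M (A - l)) A^k. *)
Lemma mx_pow_bound (r : R) A (s : seq F) M : 0 < r -> (forall l, l \in s -> ab l <= r) ->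
  M * \prod_(l <- s) (A - l%:M) = 0 ->
  exists2 C : R, 0 <= C & forall k, mx_le (C * r ^+ k) (M * A ^+ k).
Proof.
move=> r0; elim: s M => [|l s IH] M hs.
  rewrite big_nil mulr1 => ->; exists 0 => // k i j.
  by rewrite mul0r mul0r mxE (uabs0 hab).
rewrite big_cons mulrA => /IH[m ms|C C0 hC]; first by rewrite hs // inE ms orbT.
apply: (linear_rec_bound (y := fun k => M * (A - l%:M) * A ^+ k) r0 (hs l _) C0) => //.
  by rewrite mem_head.
move=> k; rewrite exprS mulrA mulrBr mulrBl addrC -mulmxE.
by rewrite mul_mx_scalar -scalemxAl subrK.
Qed.

(** Since A B = 1, M B^(k+1) = l^-1 (M B^k - M (A - l) B^(k+1)), and M (A - l) is annihilated by the
    remaining factors. *)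
Lemma mx_invpow_bound (r : R) A B (s : seq F) M : 0 < r -> A * B = 1 ->
  (forall l, l \in s -> l != 0 /\ ab l^-1 <= r) ->
  M * \prod_(l <- s) (A - l%:M) = 0 ->
  exists2 C : R, 0 <= C & forall k, mx_le (C * r ^+ k) (M * B ^+ k).
Proof.
move=> r0 AB; elim: s M => [|l s IH] M hs.
  rewrite big_nil mulr1 => ->; exists 0 => // k i j.
  by rewrite mul0r mul0r mxE (uabs0 hab).
rewrite big_cons mulrA => /IH[m ms|C C0 hC]; first by apply: hs; rewrite inE ms orbT.
have [l0 hl] := hs l (mem_head _ _).
(* One factor r bounds |l^-1|, the other comes from the exponent k+1 of B in the inhomogeneous
   term. *)
have C20 : 0 <= C * r ^+ 2 by rewrite mulr_ge0 // exprn_ge0 // ltW.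
apply: (linear_rec_bound (c := l^-1)
  (y := fun k => - (l^-1 *: (M * (A - l%:M) * B ^+ k.+1))) r0 hl C20) => k.
  rewrite -scalerBr mulrBr mulrBl -!mulrA [in A * _]exprS [A * (B * _)]mulrA AB mul1r.
  rewrite opprB addrC subrK -!mulmxE mul_scalar_mx -scalemxAr scalerA.
  by rewrite mulVf // scale1r.
move=> i j; rewrite !mxE (uabsN hab) (uabsM hab).
have -> : C * r ^+ 2 * r ^+ k = r * (C * r ^+ k.+1) by rewrite !exprS; ring.
by apply: ler_pM => //; rewrite ?(uabs_ge0 hab) //; have := hC k.+1 i j; rewrite mxE.
Qed.

End MatrixPowers.

Section Frobenius.
Variables (R : realType) (p : nat) (S : QpSetting R p).
Local Notation K := (Qp S).
Local Notation L := (Cp S).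
Local Notation emb := (@emb _ _ S).
Local Notation absC := (@absC _ _ S).
Local Notation absQ := (@absQ _ _ S).

Lemma map_mxX d (A : 'M[K]_d) k : map_mx emb (A ^+ k) = map_mx emb A ^+ k.
Proof.
elim: k => [|k IH]; first by rewrite !expr0 map_mx1.
by rewrite !exprS -!mulmxE map_mxM IH.
Qed.

Lemma eigen_prod d (phi : 'M[K]_d) (lam : 'I_d -> L) : eigen_vals phi lam ->
  \prod_(k < d) (map_mx emb phi - (lam k)%:M) = 0.
Proof.
case: d phi lam => [|d] phi lam [h _].
  by apply/matrixP => -[].
have := Cayley_Hamilton (map_mx emb phi).
rewrite -map_char_poly h rmorph_prod /= => <-; apply: eq_bigr => k _.
by rewrite rmorphB /= horner_mx_X horner_mx_C.
Qed.

Lemma eigen_vals_neq0 d (phi : 'M[K]_d) (lam : 'I_d -> L) : phi \in unitmx ->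
  eigen_vals phi lam -> forall k, lam k != 0.
Proof.
move=> hphi [h _] k; apply/eqP => lk0.
have : emb (char_poly phi).[0] == 0.
  rewrite -horner_map rmorph0 h horner_prod (bigD1 k) //= lk0 hornerXsubC subrr mul0r //.
rewrite fmorph_eq0 horner_coef0 char_poly_det mulf_eq0 signr_eq0 /= => /eqP d0.
by move: hphi; rewrite unitmxE d0 unitr0.
Qed.

(** The eigenvalues live in C_p, so Cayley-Hamilton is applied there; the absolute value on Q_p is
    the restricted one, so the bounds on entries descend. *)
Lemma frobenius_pow_bound d (phi : 'M[K]_d) (lam : 'I_d -> L) (r r' : R) :
  phi \in unitmx -> eigen_vals phi lam -> 0 < r -> 0 < r' ->
  (forall k, absC (lam k) <= r) -> (forall k, absC (lam k)^-1 <= r') ->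
  exists2 C : R, 0 <= C & forall k, mx_le absQ (C * r ^+ k) (phi ^+ k) /\
                                    mx_le absQ (C * r' ^+ k) (invmx phi ^+ k).
Proof.
move=> hphi hl r0 r'0 hr hr'; have hab := ultra_absC S.
have h0 : 1 * \prod_(l <- map lam (index_enum 'I_d)) (map_mx emb phi - l%:M) = 0.
  by rewrite mul1r big_map; exact: eigen_prod hl.
have [l /mapP[k _ ->]|C C0 hC] := mx_pow_bound hab r0 _ h0; first exact: hr.
have hV : map_mx emb phi * map_mx emb (invmx phi) = 1.
  by rewrite -mulmxE -map_mxM mulmxV // map_mx1.
have [l /mapP[k _ ->]|C' C'0 hC'] := mx_invpow_bound hab r'0 hV _ h0.
  by split; [exact: eigen_vals_neq0 hl k|exact: hr'].
exists (C + C'); first exact: addr_ge0.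
move=> k; split=> i j.
  have := hC k i j; rewrite mul1r -map_mxX mxE /Defs.absQ => h; apply: le_trans h _.
  by rewrite ler_wpM2r ?exprn_ge0 ?(ltW r0) // lerDl.
have := hC' k i j; rewrite mul1r -map_mxX mxE /Defs.absQ => h; apply: le_trans h _.
by rewrite ler_wpM2r ?exprn_ge0 ?(ltW r'0) // lerDr.
Qed.

End Frobenius.

(** * Convergence of infinite products *)

Section MatrixGauss.
Variables (R : realType) (p : nat) (S : QpSetting R p).
Local Notation K := (Qp S).
Local Notation absQ := (@absQ _ _ S).
Local Notation hab := (@ultra_absQ _ _ S).
Local Notation gb := (gbd absQ).
Local Notation cst := (@cstH _ _ S).

Lemma cstH_zmod_morphism : zmod_morphism cst.
Proof. by move=> x y; rewrite /cstH polyCB rmorphB. Qed.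

Lemma cstH_monoid_morphism : monoid_morphism cst.
Proof. by split=> [|x y]; rewrite /cstH ?polyC1 ?rmorph1 // polyCM rmorphM. Qed.

HB.instance Definition _ := GRing.isZmodMorphism.Build K (fps K) cst cstH_zmod_morphism.
HB.instance Definition _ := GRing.isMonoidMorphism.Build K (fps K) cst cstH_monoid_morphism.

Definition mbd (rho C : R) m n (A : 'M[fps K]_(m, n)) : Prop :=
  forall i j, gb rho C (A i j).

Definition inGm m n (A : 'M[fps K]_(m, n)) : Prop := forall i j, inG (A i j).

Lemma mbdM (rho C D : R) m n q (A : 'M[fps K]_(m, n)) (B : 'M[fps K]_(n, q)) :
  0 <= rho -> 0 <= C -> 0 <= D ->
  mbd rho C A -> mbd rho D B -> mbd rho (C * D) (A *m B).
Proof.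
move=> r0 C0 D0 hA hB i j; rewrite mxE; apply: (gbd_sum hab) => //; first exact: mulr_ge0.
by move=> k _; apply: (gbdM hab).
Qed.

Lemma mbd_cst (rho C : R) m n (A : 'M[K]_(m, n)) : mx_le absQ C A -> mbd rho C (map_mx cst A).
Proof. by move=> h i j; rewrite mxE; apply: gbd_le (h i j) _; apply: (gbd_polyC hab). Qed.

Lemma mx_le_ex m n (A : 'M[K]_(m, n)) : exists2 C : R, 0 <= C & mx_le absQ C A.
Proof.
have nn x : 0 <= absQ x := uabs_ge0 hab x.
exists (\sum_i \sum_j absQ (A i j)) => [|i j]; first by do 2![apply: sumr_ge0 => ? _].
rewrite (bigD1 i) //= (bigD1 j) //= -addrA lerDl addr_ge0 //.
  by apply: sumr_ge0 => ? _.
by do 2![apply: sumr_ge0 => ? _].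
Qed.

Lemma inGm_cst m n (A : 'M[K]_(m, n)) : inGm (map_mx cst A).
Proof. by move=> i j; rewrite mxE; exact: inG_poly. Qed.

Lemma inGmM m n q (A : 'M[fps K]_(m, n)) (B : 'M[fps K]_(n, q)) : inGm A -> inGm B -> inGm (A *m B).
Proof. by move=> hA hB i j; rewrite mxE; apply: inG_sum => k _; apply: inGM. Qed.

Lemma inGm_diag n (P : 'I_n -> {poly K}) : inGm (diag_mx (\row_i fps_of_poly (P i))).
Proof.
move=> i j; rewrite !mxE; case: (_ == _); first by rewrite mulr1n; exact: inG_poly.
by rewrite mulr0n -(rmorph0 (@fps_of_poly K)); exact: inG_poly.
Qed.

Lemma inGm_bound (rho : R) m n (A : 'M[fps K]_(m, n)) : 0 < rho < 1 -> inGm A ->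
  exists2 C : R, 0 <= C & mbd rho C A.
Proof.
move=> hr hA; pose c i j := projT1 (cid (hA i j _ hr)).
have hc i j : gb rho (c i j) (A i j) := projT2 (cid (hA i j _ hr)).
have c0 i j : 0 <= c i j := gbd_ge0 hab (hc i j).
exists (\sum_i \sum_j c i j) => [|i j]; first by do 2![apply: sumr_ge0 => ? _].
apply: gbd_le (hc i j); rewrite (bigD1 i) //= (bigD1 j) //= -addrA lerDl addr_ge0 //.
  by apply: sumr_ge0 => ? _.
by do 2![apply: sumr_ge0 => ? _].
Qed.

(** Once E_n is bounded by 1 the matrices Z_n stay bounded, by the ultrametric inequality; the
    increments Z_n E_n then tend to 0 with E_n. *)
Lemma cauchyG_mulmx d (Z E : nat -> 'M[fps K]_d) N : (forall n, inGm (Z n)) ->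
  (forall n, (N <= n)%N -> Z n.+1 - Z n = Z n *m E n) ->
  (forall rho : R, 0 < rho < 1 -> forall e : R, 0 < e ->
     exists M, forall n, (M <= n)%N -> mbd rho e (E n)) ->
  forall i j, cauchyG (fun n => Z n i j).
Proof.
move=> hZ hE hcv i j rho hr e e0; have r0 : 0 <= rho by case/andP: hr => /ltW.
have [M1 hM1] := hcv _ hr _ ltr01.
pose M2 := maxn N M1; have [C C0 hC] := inGm_bound hr (hZ M2).
have hb n : (M2 <= n)%N -> mbd rho C (Z n).
  elim: n => [|n IH]; first by rewrite leqn0 => /eqP <-.
  rewrite leq_eqVlt => /orP[/eqP <- //|hn k l].
  have ZE : Z n.+1 = Z n + Z n *m E n.
    by rewrite -hE ?[_ + (_ - _)]addrC ?subrK // (leq_trans (leq_maxl N M1)).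
  rewrite ZE mxE; apply: (gbdD hab r0); first exact: IH.
  rewrite -[C]mulr1; apply: mbdM => //; first exact: IH.
  by apply: hM1; rewrite (leq_trans (leq_maxr N M1)).
have C1 : 0 < C + 1 by lra.
have [M3 hM3] := hcv _ hr _ (divr_gt0 e0 C1).
exists (maxn M2 M3) => n; rewrite geq_max => /andP[n2 n3].
have -> : Z n.+1 i j - Z n i j = (Z n *m E n) i j.
  by rewrite -hE ?mxE ?mxE // (leq_trans (leq_maxl N M1)).
apply: (gbd_le (C := C * (e / (C + 1)))).
  by rewrite mulrCA ler_piMr ?(ltW e0) // ler_pdivrMr //; lra.
by apply: mbdM => //; [rewrite divr_ge0 // ltW|exact: hb|exact: hM3].
Qed.

Lemma cvgG_shift (g : nat -> fps K) f : cvgG g f -> cvgG (fun n => g n.+1) f.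
Proof.
move=> h rho hr e e0; have [M hM] := h _ hr _ e0; exists M => n Mn.
exact: hM (leqW Mn).
Qed.

Lemma cvgG_det d (Z : nat -> 'M[fps K]_d) (Zinf : 'M[fps K]_d) : inGm Zinf ->
  (forall i j, cvgG (fun n => Z n i j) (Zinf i j)) ->
  cvgG (fun n => \det (Z n)) (\det Zinf).
Proof.
move=> hZ h; apply: cvgG_sum => s; apply: cvgGM.
- rewrite -(rmorph1 (@fps_of_poly K)) -rmorphN -rmorphXn; exact: inG_poly.
- elim: (index_enum _) => [|i r IH]; last by rewrite big_cons; apply: inGM.
  by rewrite big_nil -[1](rmorph1 (@fps_of_poly K)); apply: inG_poly.
- exact: cvgG_cst.
- exact: cvgG_prod.
Qed.

End MatrixGauss.

(** * Decay of the interpolation polynomials towards 1 and the limits Xi *)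

Section XitConvergence.
Variables (R : realType) (p : nat) (S : QpSetting R p).
Hypotheses (hp : prime p) (hodd : odd p).
Local Notation K := (Qp S).
Local Notation hab := (@ultra_absQ _ _ S).
Local Notation pV := (p%:R^-1 : R).
Local Notation gb rho C P := (gbd (@absQ _ _ S) rho C (fps_of_poly P)).
Variable u : K.
Hypothesis hu : topgen u.

(** In terms of omega_n each twist is al omega_n + (al - 1), and both terms are O(p^(-n)). *)
Lemma omegaS_bound (rho : R) J : 0 < rho < 1 ->
  exists C : R, forall n, gb rho (C * (pV ^+ size J) ^+ n) (omegaS u n J).
Proof.
move=> hr; have r0 : 0 <= rho by case/andP: hr => /ltW.
have [C hC] := omega_bound S hp hr; exists (Num.max C 1 ^+ size J) => n.
have -> : Num.max C 1 ^+ size J * (pV ^+ size J) ^+ n = (Num.max C 1 * pV ^+ n) ^+ size J.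
  by rewrite exprMn -!exprM mulnC.
rewrite /omegaS rmorph_prod; apply: (gbd_prod hab) => // j.
have pn0 : 0 <= pV ^+ n by rewrite exprn_ge0 // ltW ?pV_gt0.
have -> : twist u j (omega S n) = (al u n j)%:P * omega S n + (al u n j - 1)%:P.
  by rewrite twist_omega lin_comp mulrDr mulr1 polyCB addrA.
rewrite rmorphD rmorphM; apply: (gbdD hab) => //=.
  apply: (gbd_le (C := 1 * (C * pV ^+ n))).
    by rewrite mul1r ler_wpM2r // le_max lexx.
  by apply: (gbdM hab) => //; rewrite -(al_abs hp hu n j); apply: (gbd_polyC hab).
apply: gbd_le (gbd_polyC hab _ _).
apply: le_trans (al_sub1_le hp hodd hu n j) _; rewrite exprS ler_wpM2r //.
by rewrite le_max (ltW (pV_lt1 _ hp)) orbT.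
Qed.

Lemma xit_bound (rho : R) J' J : 0 < rho < 1 -> uniq J -> uniq J' -> {subset J' <= J} ->
  (0 < size J)%N ->
  exists C : R, forall n, gb rho (C * (pV ^+ size J) ^+ n) (xit u n.+1 J' J - 1).
Proof.
move=> hr uJ uJ' sJ J0; have [C hC] := omegaS_bound J hr.
have r01 : 0 <= rho <= 1 by case/andP: hr => ? ?; rewrite !ltW.
have r0 : 0 <= rho by case/andP: r01.
exists (C * (pV ^+ size J')^-1 ^+ size J) => n.
have [G [-> gG]] := xitS hp hodd hu n uJ uJ' sJ J0.
rewrite addrAC subrr add0r rmorphM mulrAC; apply: (gbdM hab) => //.
apply: (gbd_comp hab) => //; apply: gbd_le (omega_bound1 S hp n r01).
by case/andP: r01.
Qed.


Lemma XiLim_ex N J' J : uniq J -> uniq J' -> {subset J' <= J} -> (0 < size J)%N ->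
  exists X, inG X /\
    cvgG (fun M => fps_of_poly (\prod_(N <= m < M) xit u m J' J)) X.
Proof.
move=> uJ uJ' sJ J0.
pose g M : fps K := fps_of_poly (\prod_(N <= m < M) xit u m J' J).
suff : cauchyG g.
  move=> /cauchyG_cvgG[X hX]; exists X; split => //.
  by apply: inG_cvgG hX => n; exact: inG_poly.
(* Scalar products are treated as products of 1 by 1 matrices. *)
have := @cauchyG_mulmx _ _ S 1 (fun n => (g n)%:M)
  (fun n => (fps_of_poly (xit u n J' J - 1))%:M) N.
move=> h; have {h} : forall i j, cauchyG (fun n => ((g n)%:M : 'M[fps K]_1) i j).
  apply: h => [n i j|n Nn|rho hr e e0].
  - by rewrite mxE !ord1 eqxx mulr1n; exact: inG_poly.
  - rewrite -raddfB -scalar_mxM -rmorphM; congr (_%:M).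
    by rewrite /g -rmorphB big_nat_recr //= mulrBr mulr1.
  - have [C hC] := xit_bound hr uJ uJ' sJ J0.
    have hq : 0 <= pV ^+ size J < 1.
      have := pV_gt0 R hp; have := pV_lt1 R hp => h1 h0.
      by rewrite exprn_ge0 ?(ltW h0) //= exprn_ilt1 ?(ltW h0) // -lt0n.
    have [M hM] := geometric_small C hq e0.
    (* The estimate of index n concerns level n+1, so the level 0 polynomial, of a different form,
       is skipped. *)
    exists M.+1 => -[//|n] Mn i j; rewrite mxE !ord1 eqxx mulr1n.
    by apply: gbd_le (hC n); exact: hM.
by move=> /(_ 0 0); under eq_fun do rewrite mxE eqxx mulr1n.
Qed.

End XitConvergence.

(** * The sequence Z_n *)

Lemma mem_itv (a b j : int) : (j \in itv a b) = (a < j <= b).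
Proof.
rewrite /itv; case: ifPn => [ab|]; last first.
  rewrite -leNgt => ba; rewrite in_nil; apply/esym/negP => /andP[h1 h2].
  by have := lt_le_trans h1 (le_trans h2 ba); rewrite ltxx.
have ab0 : 0 <= b - a by rewrite subr_ge0 ltW.
apply/mapP/andP => [[i]|[aj jb]].
  rewrite mem_iota add0n /= => hi ->; split; first by rewrite ltrDl.
  by rewrite -lerBrDl -(gez0_abs ab0) lez_nat.
have j0 : 0 < j - a by rewrite subr_gt0.
exists `|j - a|.-1%N; last first.
  by rewrite prednK ?absz_gt0 ?gt_eqF // gez0_abs ?(ltW j0) // [RHS]addrC subrK.
rewrite mem_iota add0n /= prednK ?absz_gt0 ?gt_eqF //.
by rewrite -lez_nat !gez0_abs ?(ltW j0) // lerD2r.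
Qed.

Lemma itv_uniq a b : uniq (itv a b).
Proof.
rewrite /itv; case: ifP => // _; rewrite map_inj_uniq ?iota_uniq // => i j.
by move=> /addrI[].
Qed.

Lemma size_itv a b : a <= b -> (size (itv a b))%:Z = b - a.
Proof.
rewrite le_eqVlt /itv => /orP[/eqP->|ab]; first by rewrite ltxx subrr.
by rewrite ab size_map size_iota gez0_abs // subr_ge0 ltW.
Qed.

Lemma mulmx_conj_sub1 (A : comNzRingType) d (M U T V : 'M[A]_d) : U *m V = 1%:M ->
  M *m U *m T *m V - M = M *m (U *m (T - 1%:M) *m V).
Proof.
by move=> UV; rewrite mulmxBr mulmx1 mulmxBl UV mulmxBr mulmx1 !mulmxA.
Qed.

Lemma det_conj_diag (A : comNzRingType) d (M U U' V V' : 'M[A]_d) (D : 'rV[A]_d) :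
  U *m V = 1%:M -> U' *m V' = 1%:M ->
  \det (M *m U *m (U' *m diag_mx D *m V') *m V) = \det M * \prod_k D 0 k.
Proof.
move=> /(congr1 determinant); rewrite det_mulmx det1 => UV.
move=> /(congr1 determinant); rewrite det_mulmx det1 => UV'.
rewrite !det_mulmx det_diag; set q := \prod_k _.
transitivity (\det M * q * (\det U * \det V) * (\det U' * \det V')); first by ring.
by rewrite UV UV' !mulr1.
Qed.

Section ZSequence.
Variables (R : realType) (p : nat) (S : QpSetting R p).
Hypotheses (hp : prime p) (hodd : odd p).
Local Notation K := (Qp S).
Local Notation absQ := (@absQ _ _ S).
Local Notation hab := (@ultra_absQ _ _ S).
Local Notation pV := (p%:R^-1 : R).
Local Notation cst := (@cstH _ _ S).
Variables (u : K) (d : nat) (phi B : 'M[K]_d) (t : 'I_d -> int) (td a b : int).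
Hypotheses (hphi : phi \in unitmx) (hB : B \in unitmx).
Local Notation J := (itv a b).
Local Notation T := (Tmat u B t td a b).
Local Notation Z := (Zseq u phi B t td a b).
Local Notation Xt k n := (xit u n (itv (t k) td) J).

Lemma cst_mul_inv (A A' : 'M[K]_d) : A *m A' = 1%:M -> map_mx cst A *m map_mx cst A' = 1%:M.
Proof. by move=> h; rewrite -map_mxM h map_mx1. Qed.

Lemma phi_pow_inv n : invmx phi ^+ n *m phi ^+ n = 1%:M.
Proof.
elim: n => [|n IH]; first by rewrite !expr0 mulmx1.
by rewrite exprSr exprS -!mulmxE mulmxA -(mulmxA _ (invmx phi)) mulVmx // mulmx1.
Qed.

(** The deviation from the identity of the conjugate of T_n. Matrices act on rows, so phi^(-(n+1)),
    which is applied first, stands on the left. *)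
Definition Edev n : 'M[fps K]_d :=
  map_mx cst (invmx phi ^+ n.+1) *m (T n - 1%:M) *m map_mx cst (phi ^+ n.+1).

Lemma Tmat_sub1 n : T n - 1%:M = map_mx cst (invmx B) *m
  diag_mx (\row_k fps_of_poly (Xt k n - 1)) *m map_mx cst B.
Proof.
have -> : diag_mx (\row_k fps_of_poly (Xt k n - 1)) =
    diag_mx (\row_k fps_of_poly (Xt k n)) - 1%:M.
  by apply/matrixP => i j; rewrite !mxE rmorphB rmorph1 mulrnBl.
by rewrite mulmxBr mulmx1 mulmxBl cst_mul_inv // mulVmx.
Qed.

Lemma ZseqS N n : (N <= n)%N -> Z N n.+1 - Z N n = Z N n *m Edev n.+1.
Proof.
move=> Nn; have -> : Z N n.+1 = Zstep u phi B t td a b n.+1 (Z N n).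
  by rewrite /= ltnNge (leq_trans Nn).
by apply: mulmx_conj_sub1; apply: cst_mul_inv; exact: phi_pow_inv.
Qed.

Lemma Zstep_inGm n M : inGm M -> inGm (Zstep u phi B t td a b n M).
Proof.
move=> hM; rewrite /Zstep /Tmat.
do ![apply: inGmM => //; try exact: inGm_cst]; exact: inGm_diag.
Qed.

Lemma inGm1 : inGm (1%:M : 'M[fps K]_d).
Proof. by rewrite -(map_mx1 cst); exact: inGm_cst. Qed.

Lemma Zseq_inGm N n : inGm (Z N n).
Proof.
elim: n => [|n IH] /=; case: ifP => _; rewrite ?inGm1 //; try exact: inGm1.
  by apply: Zstep_inGm; exact: inGm1.
exact: Zstep_inGm.
Qed.

Lemma det_Zstep n M : \det (Zstep u phi B t td a b n M) =
  \det M * \prod_k fps_of_poly (Xt k n).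
Proof.
rewrite /Zstep /Tmat (det_conj_diag _ _ (cst_mul_inv (phi_pow_inv _)) (cst_mul_inv (mulVmx hB))).
by congr (_ * _); apply: eq_bigr => k _; rewrite mxE.
Qed.

Lemma det_Zseq N n :
  \det (Z N n) = \prod_k fps_of_poly (\prod_(N <= m < n.+1) Xt k m).
Proof.
elim: n => [|n IH].
  case: N => [|N] /=.
    rewrite det_Zstep det1 mul1r; apply: eq_bigr => k _.
    by rewrite big_nat1.
  by rewrite det1 big1 // => k _; rewrite big_geq // rmorph1.
rewrite [Z _ _]/=; case: ltnP => hN.
  by rewrite det1 big1 // => k _; rewrite big_geq // rmorph1.
rewrite det_Zstep IH -big_split /=; apply: eq_bigr => k _.
by rewrite [in RHS]big_nat_recr //= rmorphM.
Qed.

Hypotheses (hu : topgen u) (hJ0 : (0 < size J)%N).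
Hypothesis hsub : forall k, {subset itv (t k) td <= J}.

Lemma Zseq_congr N n : (N <= n)%N -> forall i j,
  divH (fps_of_poly (omegaS u n J)) ((Z N n.+1 - Z N n) i j).
Proof.
move=> Nn i j.
have hG k : exists G : {poly K}, Xt k n.+1 = 1 + omegaS u n J * (G \Po omega S n).
  have [G [e _]] := xitS hp hodd hu n (itv_uniq a b) (itv_uniq (t k) td) (hsub (k := k)) hJ0.
  by exists G.
pose G k := projT1 (cid (hG k)).
have eG k : Xt k n.+1 = 1 + omegaS u n J * (G k \Po omega S n) := projT2 (cid (hG k)).
pose D : 'M[fps K]_d := diag_mx (\row_k fps_of_poly (G k \Po omega S n)).
(* The factor omega_n^J is common to all diagonal entries, so it comes out as a scalar and passes
   through the conjugations. *)
have eD : diag_mx (\row_k fps_of_poly (Xt k n.+1 - 1)) = fps_of_poly (omegaS u n J) *: D.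
  apply/matrixP => k l; rewrite !mxE eG addrAC subrr add0r rmorphM.
  by rewrite mulrnAr.
pose H := Z N n *m (map_mx cst (invmx phi ^+ n.+2) *m
  (map_mx cst (invmx B) *m D *m map_mx cst B) *m map_mx cst (phi ^+ n.+2)).
exists (H i j); split.
  apply: inG_inH; rewrite /H; apply: inGmM; first exact: Zseq_inGm.
  do ![apply: inGmM => //; try exact: inGm_cst]; exact: inGm_diag.
rewrite ZseqS // /Edev Tmat_sub1 eD -scalemxAr -!scalemxAl -!scalemxAr -!scalemxAl.
by rewrite -scalemxAr mxE.
Qed.

Variables (r r' : R).
Variable lam : 'I_d -> Cp S.
Hypothesis hlam : eigen_vals phi lam.
Hypotheses (r0 : 0 < r) (r'0 : 0 < r').
Hypothesis hr : forall k, @absC _ _ S (lam k) <= r.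
Hypothesis hr' : forall k, @absC _ _ S (lam k)^-1 <= r'.
Hypothesis hq : r' * r * pV ^+ size J < 1.

Lemma Edev_small (rho : R) : 0 < rho < 1 -> forall e : R, 0 < e ->
  exists M, forall n, (M <= n)%N -> mbd rho e (Edev n.+1).
Proof.
move=> hrho e e0; have rho0 : 0 <= rho by case/andP: hrho => /ltW.
have [C C0 hC] := frobenius_pow_bound hphi hlam r0 r'0 hr hr'.
have [C1 C10 hC1] := mx_le_ex (invmx B).
have [C2 C20 hC2] := mx_le_ex B.
have hX k := xit_bound hp hodd hu hrho (itv_uniq a b) (itv_uniq (t k) td) (hsub (k := k)) hJ0.
pose c k := projT1 (cid (hX k)).
have hc k n : gbd absQ rho (c k * (pV ^+ size J) ^+ n) (fps_of_poly (Xt k n.+1 - 1)) :=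
  projT2 (cid (hX k)) n.
have c0 k : 0 <= c k.
  by have := gbd_ge0 hab (hc k 0%N); rewrite expr0 mulr1.
pose C3 := \sum_k c k.
have C30 : 0 <= C3 by apply: sumr_ge0 => k _.
have pJ0 : 0 <= pV ^+ size J by rewrite exprn_ge0 // ltW ?pV_gt0.
have hdiag n : mbd rho (C3 * (pV ^+ size J) ^+ n) (diag_mx (\row_k fps_of_poly (Xt k n.+1 - 1))).
  move=> i j; rewrite !mxE; case: (i == j); last first.
    by rewrite mulr0n; apply: (gbd0 hab); rewrite mulr_ge0 ?exprn_ge0.
  rewrite mulr1n; apply: gbd_le (hc i n); rewrite ler_wpM2r ?exprn_ge0 //.
  by rewrite /C3 (bigD1 i) //= lerDl sumr_ge0.
(* The squares arise because level n+1 is conjugated by phi^(n+2). *)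
pose C4 := C * r' ^+ 2 * (C1 * C3 * C2) * (C * r ^+ 2).
have hq0 : 0 <= r' * r * pV ^+ size J < 1.
  by rewrite hq andbT !mulr_ge0 // ltW.
have [M hM] := geometric_small C4 hq0 e0.
exists M => n Mn i j; apply: (gbd_le (hM n Mn)).
have -> : C4 * (r' * r * pV ^+ size J) ^+ n =
    (C * r' ^+ n.+2) * (C1 * (C3 * (pV ^+ size J) ^+ n) * C2) * (C * r ^+ n.+2).
  by rewrite /C4 !exprMn !(exprS _ n.+1) !(exprS _ n); ring.
have rn0 k : 0 <= r ^+ k by rewrite exprn_ge0 // ltW.
have r'n0 k : 0 <= r' ^+ k by rewrite exprn_ge0 // ltW.
have pn0 k : 0 <= (pV ^+ size J) ^+ k by rewrite exprn_ge0.
move: i j; change (mbd rho ((C * r' ^+ n.+2) * (C1 * (C3 * (pV ^+ size J) ^+ n) * C2) *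
  (C * r ^+ n.+2)) (Edev n.+1)); rewrite /Edev Tmat_sub1.
have U1 := mulr_ge0 C0 (r'n0 n.+2); have U2 := mulr_ge0 C0 (rn0 n.+2).
have U3 := mulr_ge0 C30 (pn0 n); have U4 := mulr_ge0 C10 U3.
have U5 := mulr_ge0 U4 C20; have U6 := mulr_ge0 U1 U5.
have [hV hV'] := hC n.+2.
refine (mbdM rho0 U6 U2 (mbdM rho0 U1 U5 (mbd_cst rho hV') _) (mbd_cst rho hV)).
exact: (mbdM rho0 U4 C20 (mbdM rho0 C10 U3 (mbd_cst rho hC1) (hdiag n)) (mbd_cst rho hC2)).
Qed.

Lemma Zseq_cvg N : exists Zinf : 'M[fps K]_d,
  inGm Zinf /\ forall i j, cvgG (fun n => Z N n i j) (Zinf i j).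
Proof.
have hcauchy i j : cauchyG (fun n => Z N n i j).
  apply: (@cauchyG_mulmx _ _ _ _ (Z N) (fun n => Edev n.+1) N).
  - exact: Zseq_inGm.
  - exact: ZseqS.
  - exact: Edev_small.
have hl i j := cauchyG_cvgG (hcauchy i j).
exists (\matrix_(i, j) projT1 (cid (hl i j))).
have hcv i j : cvgG (fun n => Z N n i j) ((\matrix_(i, j) projT1 (cid (hl i j))) i j).
  by rewrite mxE; exact: projT2 (cid (hl i j)).
split => // i j; apply: inG_cvgG (hcv i j) => n; exact: Zseq_inGm.
Qed.

Lemma Zseq_limit N : exists Zinf : 'M[fps K]_d,
  [/\ inGm Zinf,
      forall (v : 'rV[K]_d) j,
        cvgG (fun n => (map_mx cst v *m Z N n) 0 j) ((map_mx cst v *m Zinf) 0 j) &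
      exists2 Xi : 'I_d -> fps K, forall k, XiLim u N (itv (t k) td) J (Xi k) &
        \det Zinf = \prod_k Xi k].
Proof.
have [Zinf [iZ cZ]] := Zseq_cvg N; exists Zinf; split => //.
  move=> v j; rewrite mxE; under eq_fun do rewrite mxE.
  apply: cvgG_sum => k; apply: cvgGM => //; rewrite ?mxE; first exact: inG_poly.
  exact: cvgG_cst.
have hX k := XiLim_ex hp hodd hu N (itv_uniq a b) (itv_uniq (t k) td) (hsub (k := k)) hJ0.
pose Xi k := projT1 (cid (hX k)).
have [iX cX] : (forall k, inG (Xi k)) /\ forall k,
    cvgG (fun M => fps_of_poly (\prod_(N <= m < M) Xt k m)) (Xi k).
  by split=> k; case: (projT2 (cid (hX k))).
exists Xi; first by move=> k; split; [exact: inG_inH|exact: cvgG_cvgH].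
(* Both sides are limits of det Z_n. *)
apply: cvgG_unique (cvgG_det iZ cZ) _.
under eq_fun do rewrite det_Zseq.
(* det Z_n includes the factor of index n, whence the shift by one in the partial products. *)
by apply: cvgG_prod => // k; exact: cvgG_shift (cX k).
Qed.

End ZSequence.

Theorem mainTheorem8 (R : realType) (p : nat) (S : QpSetting R p)
  (hp : prime p) (hodd : odd p)
  (u : Qp S) (hu : topgen u)
  (d : nat) (hd : (0 < d)%N)
  (phi : 'M[Qp S]_d) (hphi : phi \in unitmx)
  (Fil : int -> 'M[Qp S]_d) (hFil : filtration Fil)
  (tHT : 'I_d -> int) (htHT : HT_weights Fil tHT)
  (lam : 'I_d -> Cp S) (hlam : eigen_vals phi lam)
  (B : 'M[Qp S]_d) (hB : adapted_basis Fil tHT B)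
  (tp : int)
  (htp : tprime_spec (tHT (ord_first hd)) (tHT (ord_last hd))
           (vp (lam (ord_last hd)) - vp (lam (ord_first hd))) tp)
  (a b : int)
  (hJ : forall j : int, tHT (ord_first hd) < j <= tp -> a < j <= b)
  (N : nat) :
  let Z := Zseq u phi B tHT (tHT (ord_last hd)) a b N in
  (forall n : nat, (N <= n)%N -> forall i j : 'I_d,
     divH (fps_of_poly (omegaS u n (itv a b))) ((Z n.+1 - Z n) i j)) /\
  exists Zinf : 'M[fps (Qp S)]_d,
    (forall i j : 'I_d, inH (Zinf i j)) /\
    (forall (v : 'rV[Qp S]_d) (j : 'I_d),
       cvgH (fun n => (map_mx (@cstH _ _ S) v *m Z n) 0 j)
              ((map_mx (@cstH _ _ S) v *m Zinf) 0 j)) /\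
    exists Xi : 'I_d -> fps (Qp S),
      (forall k : 'I_d,
         XiLim u N (itv (tHT k) (tHT (ord_last hd))) (itv a b) (Xi k)) /\
      exists w : fps (Qp S), unitH w /\ \det Zinf = w * \prod_(k < d) Xi k.
Proof.
move=> Z; set td := tHT (ord_last hd) in htp hJ Z *.
set t1 := tHT (ord_first hd) in htp hJ *.
case: hB => uB _; case: htHT => mono _; have [_ lmono] := hlam.
have t1_le k : t1 <= tHT k by apply: mono.
have le_td k : tHT k <= td by apply: mono; rewrite /= -ltnS prednK.
have l0 := eigen_vals_neq0 hphi hlam.
have hab := ultra_absC S.
have al0 k : 0 < absC (lam k) by rewrite (uabs_gt0 hab).
have lnp : 0 < ln (p%:R : R) by rewrite ln_gt0 // ltr1n prime_gt1.
case: htp => td_tp [Delta_lt _].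
set Delta := vp _ - vp _ in Delta_lt.
(* Absolute values decrease as valuations increase: lam_1 is the largest and governs phi^n, lam_d is
   the smallest and governs phi^(-n). *)
have vp_ge (i j : 'I_d) : (i <= j)%N -> absC (lam j) <= absC (lam i).
  move=> /lmono; rewrite /vp !mulNr lerN2 ler_pM2r ?invr_gt0 //.
  by rewrite ler_ln ?posrE.
have Delta0 : 0 <= Delta by rewrite subr_ge0; apply: lmono.
(* As Delta >= 0, the interval from t1 to tp is nonempty; its extreme elements t1 + 1 and tp then
   locate a and b. *)
have t1_lt : t1 < tp.
  by rewrite -subr_gt0 -(ltr0z R); apply: le_lt_trans Delta_lt.
have [a_t1 tp_b] : a <= t1 /\ tp <= b.
  have h1 : a < t1 + 1 <= b by apply: hJ; rewrite ltrDl ltr01 /= lezD1.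
  have h2 : a < tp <= b by apply: hJ; rewrite t1_lt lexx.
  by case/andP: h1 => h1 _; case/andP: h2 => _ h2; rewrite -ltzD1.
have ab : a < b by apply: le_lt_trans a_t1 (lt_le_trans t1_lt tp_b).
have sJ := size_itv (ltW ab).
have J0 : (0 < size (itv a b))%N by rewrite -ltz_nat sJ subr_gt0.
have sub k : {subset itv (tHT k) td <= itv a b}.
  move=> j; rewrite !mem_itv => /andP[h1 h2].
  by rewrite (le_lt_trans (le_trans a_t1 (t1_le k)) h1) (le_trans h2 (le_trans td_tp tp_b)).
have DJ : Delta < (size (itv a b))%:R.
  rewrite pmulrn sJ; apply: lt_le_trans Delta_lt _.
  by rewrite ler_int lerD // lerN2.
(* Since |lam_1| / |lam_d| = p^Delta, this is Delta < #|J| after taking logarithms. *)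
have hq : (absC (lam (ord_last hd)))^-1 * absC (lam (ord_first hd)) *
    p%:R^-1 ^+ size (itv a b) < 1.
  have p0 : 0 < (p%:R^-1 : R) := pV_gt0 R hp.
  rewrite -ltr_ln ?posrE ?ltr01 ?mulr_gt0 ?invr_gt0 ?exprn_gt0 //.
  rewrite ln1 !lnM ?posrE ?mulr_gt0 ?invr_gt0 ?exprn_gt0 //.
  rewrite lnXn // !lnV ?posrE ?ltr0n ?prime_gt0 //.
  have : Delta * ln p%:R < (size (itv a b))%:R * ln p%:R by rewrite ltr_pM2r.
  rewrite /Delta /vp mulrBl !divfK ?gt_eqF // mulNrn -mulr_natl; lra.
have r'0 : 0 < (absC (lam (ord_last hd)))^-1 by rewrite invr_gt0.
have hr k : absC (lam k) <= absC (lam (ord_first hd)) by exact: vp_ge.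
have hr' k : absC (lam k)^-1 <= (absC (lam (ord_last hd)))^-1.
  by rewrite (uabsV hab) lef_pV2 ?posrE // vp_ge //= -ltnS prednK.
have [Zinf [iZ cZ [Xi hXi eXi]]] :=
  Zseq_limit hp hodd hphi uB hu J0 sub hlam (al0 _) r'0 hr hr' hq N.
split; first by move=> n; exact: Zseq_congr.
exists Zinf; split; first by move=> i j; exact: inG_inH.
split; first by move=> v j; exact: cvgG_cvgH.
exists Xi; split => //; exists 1; split; last by rewrite mul1r.
have h1 : inH (1 : fps (Qp S)).
  by apply: inG_inH; rewrite -(rmorph1 (@fps_of_poly (Qp S))); exact: inG_poly.
by split => //; exists 1; rewrite mulr1.
Qed.
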